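(* Let $m\ge n\ge1$, $\mathfrak g=\mathfrak{sl}(m+1|n)$ with the data below, and let $\Lambda\in\hat{\mathfrak h}^*$ have level $k\neq0$ and satisfy $(\Lambda|\beta_i)=0$ for $i=1,\dots,n$. Then $L(\Lambda)$ is integrable if and only if $\Lambda=k\Lambda_0+\sum_{i=1}^nk_i\beta_i+\sum_{i=n+1}^mk_i\epsilon_i+c\delta$ for some $c\in\mathbb{C}$ and integers $k_1,\dots,k_m$ such that $k\in\mathbb{Z}_{>0}$, $k_i\in\mathbb{Z}_{\ge0}$ for all $i$, and $k\ge k_1\ge k_2\ge\dots\ge k_m$.
   Context: Affine setting: $\mathfrak g$ is a basic Lie superalgebra with nondegenerate invariant supersymmetric form $(\cdot|\cdot)$ and Cartan subalgebra $\mathfrak h\subset\mathfrak g_{\bar0}$, identified with $\mathfrak h^*$. $\hat{\mathfrak g}=\mathfrak g[t,t^{-1}]\oplus\mathbb{C}K\oplus\mathbb{C}d$ with $[at^r,bt^s]=[a,b]t^{r+s}+r\delta_{r,-s}(a|b)K$, $K$ central, $[d,at^r]=rat^r$; $\hat{\mathfrak h}=\mathfrak h\oplus\mathbb{C}K\oplus\mathbb{C}d$ with form extended by $(\mathfrak h|\mathbb{C}K+\mathbb{C}d)=0$, $(K|K)=(d|d)=0$, $(K|d)=1$, and $\delta,\Lambda_0\in\hat{\mathfrak h}^*$ correspond to $K,d$. Given simple roots $\Pi$ of $\mathfrak g$ with highest root $\theta$, the positive roots of $\hat{\mathfrak g}$ are the positive roots of $\mathfrak g$ and all $\alpha+r\delta$,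 $\alpha$ a root or $0$, $r>0$; the simple roots are $\{\alpha_0=\delta-\theta\}\cup\Pi$. $L(\Lambda)$ is the irreducible highest weight module with highest weight $\Lambda$ (even highest weight vector) and level $\Lambda(K)$. For a positive root $\gamma$, $L(\Lambda)$ is $\gamma$-integrable if $\hat{\mathfrak g}_{-\gamma}$ acts locally nilpotently; given a distinguished subalgebra $\mathfrak g^\#_{\bar0}\subset\mathfrak g_{\bar0}$ with root set $\Delta^\#_{\bar0}$, $L(\Lambda)$ is integrable if it is $\gamma$-integrable for all positive $\gamma\in\Delta^\#_{\bar0}$ and all $\gamma=\alpha+r\delta$ with $\alpha\in\Delta^\#_{\bar0}$, $r\in\mathbb{Z}_{>0}$. Data: $\mathfrak h$ = supertraceless diagonal matrices, $(a|b)=\operatorname{str}(ab)$; $\epsilon_1,\dots,\epsilon_{m+1},\delta_1,\dots,\delta_n$ are the coordinate functionals on diagonal matrices (restricted to $\mathfrak h$), with $(\epsilon_i|\epsilon_j)=\delta_{ij}$, $(\delta_i|\delta_j)=-\delta_{ij}$, $(\epsilon_i|\delta_j)=0$. Even roots $\epsilon_i-\epsilon_j$, $\delta_i-\delta_j$; odd roots $\pm(\epsilon_i-\delta_j)$. $\mathfrak g^\#_{\bar0}\cong\mathfrak{sl}(m+1)$ with roots $\epsilon_i-\epsilon_j$. Simple roots: $\alpha_{2i-1}=\epsilon_i-\delta_i$, $\alpha_{2i}=\delta_i-\epsilon_{i+1}$ ($1\le i\le n$), $\alpha_i=\epsilon_{i-n}-\epsilon_{i-n+1}$ ($2n+1\le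 i\le m+n$); $\theta=\epsilon_1-\epsilon_{m+1}$. $\beta_i=\epsilon_i-\delta_i$, $i=1,\dots,n$. *)

(* Defs.v *)
From mathcomp Require Import all_boot all_order all_algebra.
From mathcomp Require Import reals.
From mathcomp.real_closed Require Import complex.

Set Implicit Arguments.
Unset Strict Implicit.
Unset Printing Implicit Defensive.
Import Order.TTheory GRing.Theory Num.Theory.
Local Open Scope ring_scope.

Section AffineSl.
Variable R : realType.
Local Notation C := (R[i])%C.
Variables m n : nat.
(* matrix size m+1+n ; indices 0..m are the even coordinates
   eps_1..eps_{m+1}, indices m+1..m+n are the odd ones delta_1..delta_n *)
Local Notation N := (m + n).+1.
Local Notation Mx := 'M[C]_N.

Definition ix (i : nat) : 'I_N := inord i.

Definition par (i : 'I_N) : bool := (m < i)%N.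

(* supertrace and the invariant form (a|b) = str(ab) *)
Definition str (A : Mx) : C :=
  \sum_(i < N) (if par i then - A i i else A i i).

Definition in_g (A : Mx) : bool := str A == 0.
Definition in_h (A : Mx) : bool := is_diag_mx A && in_g A.

Definition part (p : bool) (A : Mx) : Mx :=
  \matrix_(i, j) (if (par i (+) par j) == p then A i j else 0).
Definition homog (p : bool) (A : Mx) : Prop := part p A = A.

Definition sbr (p q : bool) (a b : Mx) : Mx :=
  a *m b - (-1) ^+ (p && q) *: (b *m a).

(* position of a coordinate in the ordering
   eps_1 < delta_1 < eps_2 < ... < eps_n < delta_n < eps_{n+1} < ... < eps_{m+1}
   determined by the simple roots alpha_1, ..., alpha_{m+n};
   the positive roots of g are the  x - y  with x before y, and the
   corresponding positive root vectors are the E_{pq} with pos p < pos q. *)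
Definition pos (i : 'I_N) : nat :=
  if (i <= m)%N then (if (i < n)%N then 2 * i else n + i)%N
  else (2 * (i - m) - 1)%N.

Definition lin (V : lmodType C) (f : V -> V) : Prop :=
  forall (c : C) (x y : V), f (c *: x + y) = c *: f x + f y.

(* A (Z/2-graded) module over ghat = g[t,t^-1] + CK + Cd on the C-vector
   space V : sigma is the parity involution, rho a r is the action of a t^r
   (a in g, r in Z), rK and rd the actions of K and d. *)
Definition ghat_module (V : lmodType C) (sigma : V -> V)
    (rho : Mx -> int -> V -> V) (rK rd : V -> V) : Prop :=
  [/\ (lin sigma /\ forall x, sigma (sigma x) = x),
      (forall a r, in_g a -> lin (rho a r)) /\ lin rK /\ lin rd,
      (forall r (c : C) a b x, in_g a -> in_g b ->
         rho (c *: a + b) r x = c *: rho a r x + rho b r x),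
      ((forall (p : bool) a r x, in_g a -> homog p a ->
          sigma (rho a r x) = (-1) ^+ p *: rho a r (sigma x)) /\
       (forall x, sigma (rK x) = rK (sigma x)) /\
       (forall x, sigma (rd x) = rd (sigma x))) &
      [/\ (forall (p q : bool) a b r s x, in_g a -> in_g b ->
             homog p a -> homog q b ->
             rho a r (rho b s x) - (-1) ^+ (p && q) *: rho b s (rho a r x)
             = rho (sbr p q a b) (r + s) x
               + (if r == - s then r%:~R * str (a *m b) else 0) *: rK x),
          (forall a r x, in_g a -> rK (rho a r x) = rho a r (rK x)),
          (forall x, rK (rd x) = rd (rK x)) &
          (forall a r x, in_g a ->
             rd (rho a r x) - rho a r (rd x) = r%:~R *: rho a r x)]].

(* weights: a weight is a linear functional on hhat = h + CK + Cd, written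
   Lam h x y  for its value on  h + x K + y d *)
Definition wlin (Lam : Mx -> C -> C -> C) : Prop :=
  forall (c : C) h1 h2 x1 x2 y1 y2, in_h h1 -> in_h h2 ->
    Lam (c *: h1 + h2) (c * x1 + x2) (c * y1 + y2)
    = c * Lam h1 x1 y1 + Lam h2 x2 y2.

Definition Lambda0 (h : Mx) (x y : C) : C := x.     (* Lambda_0 <-> d *)
Definition deltaw (h : Mx) (x y : C) : C := y.      (* delta <-> K *)
(* epsw i = eps_{i+1}, deltw j = delta_{j+1}  (0-based) *)
Definition epsw (i : nat) (h : Mx) (x y : C) : C := h (ix i) (ix i).
Definition deltw (j : nat) (h : Mx) (x y : C) : C :=
  h (ix (m.+1 + j)) (ix (m.+1 + j)).
Definition betaw (i : nat) (h : Mx) (x y : C) : C :=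
  epsw i h x y - deltw i h x y.

Definition hform (h : Mx) (x y : C) (h' : Mx) (x' y' : C) : C :=
  str (h *m h') + x * y' + y * x'.

(* the element of hhat corresponding to beta_{i+1} under the form, i.e.
   hform (hbeta i) 0 0 h x y = betaw i h x y  on hhat; hence for a weight
   Lam one has (Lam | beta_{i+1}) = Lam (hbeta i) 0 0. *)
Definition hbeta (i : nat) : Mx :=
  delta_mx (ix i) (ix i) + delta_mx (ix (m.+1 + i)) (ix (m.+1 + i)).

(* v is a highest weight vector of weight Lam (even, nonzero, annihilated by
   the positive part of ghat w.r.t. the simple roots delta - theta, alpha_i) *)
Definition hw_vector (V : lmodType C) (sigma : V -> V)
    (rho : Mx -> int -> V -> V) (rK rd : V -> V)
    (Lam : Mx -> C -> C -> C) (v : V) : Prop :=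
  [/\ v != 0 /\ sigma v = v,
      (forall h, in_h h -> rho h 0 v = Lam h 0 0 *: v),
      rK v = Lam 0 1 0 *: v /\ rd v = Lam 0 0 1 *: v,
      (forall p q : 'I_N, (pos p < pos q)%N -> rho (delta_mx p q) 0 v = 0) &
      (forall a (r : int), in_g a -> 0 < r -> rho a r v = 0)].

Definition irreducible (V : lmodType C)
    (rho : Mx -> int -> V -> V) (rK rd : V -> V) : Prop :=
  forall W : V -> Prop,
    W 0 ->
    (forall (c : C) x y, W x -> W y -> W (c *: x + y)) ->
    (forall a r x, in_g a -> W x -> W (rho a r x)) ->
    (forall x, W x -> W (rK x)) ->
    (forall x, W x -> W (rd x)) ->
    (forall x, W x -> x = 0) \/ (forall x, W x).

Definition loc_nilpotent (V : lmodType C) (f : V -> V) : Prop :=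
  forall x, exists k : nat, iter k f x = 0.

(* integrability w.r.t. g#_0 = sl(m+1) (roots eps_i - eps_j):
   the root space ghat_{-gamma} is spanned by E_{ji} t^0 for
   gamma = eps_i - eps_j positive (i < j), and by E_{ji} t^{-r} for
   gamma = (eps_i - eps_j) + r delta, i <> j, r > 0. *)
Definition integrable (V : lmodType C) (rho : Mx -> int -> V -> V) : Prop :=
  (forall i j : 'I_N, (i < j <= m)%N -> loc_nilpotent (rho (delta_mx j i) 0))
  /\ (forall i j : 'I_N, (i <= m)%N -> (j <= m)%N -> i != j ->
        forall r : int, 0 < r -> loc_nilpotent (rho (delta_mx j i) (- r))).

End AffineSl.

Arguments ix m n i.
Arguments par m n i.
Arguments str {R} m n A.
Arguments in_g {R} m n A.
Arguments in_h {R} m n A.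
Arguments part {R} m n p A.
Arguments homog {R} m n p A.
Arguments sbr {R} m n p q a b.
Arguments pos m n i.
Arguments ghat_module {R} m n {V} sigma rho rK rd.
Arguments wlin {R} m n Lam.
Arguments Lambda0 {R} m n h x y.
Arguments deltaw {R} m n h x y.
Arguments epsw {R} m n i h x y.
Arguments deltw {R} m n j h x y.
Arguments betaw {R} m n i h x y.
Arguments hform {R} m n h x y h' x' y'.
Arguments hbeta {R} m n i.
Arguments hw_vector {R} m n {V} sigma rho rK rd Lam v.
Arguments irreducible {R} m n {V} rho rK rd.
Arguments integrable {R} m n {V} rho.

(* Main.v *)
(** Every real root vector f of affine sl(m+1) acts ad-nilpotently, so the
    vectors killed by a power of f form a submodule; by irreducibility f is
    locally nilpotent as soon as it is nilpotent on one nonzero vector.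

    Necessity is sl(2)-theory: the highest weight vector v is killed by the
    positive root vectors, so nilpotency of f on v forces the coroot eigenvalue
    to be a natural number.  The coroots of eps_j - eps_(m+1),
    eps_j - eps_(j+1) and delta - theta give k_j, k_j - k_(j+1) and k - k_1.

    Sufficiency: if f belongs to a simple even root with coroot eigenvalue a,
    then f^(a+1) v is singular, and a singular vector of lower weight in an
    irreducible module vanishes.  This covers delta - theta and the
    eps_i - eps_(i+1) with i > n.  For i <= n, eps_i - eps_(i+1) is not simple,
    but it becomes simple after the odd reflection in beta_i; since
    (Lambda|beta_i) = 0 the vector v stays singular for the reflected positive
    system, which amounts to swapping the positions of eps_i and delta_i in the
    ordering of the coordinates.  The remaining real roots are reached by
    brackets and reflections: if f and y are nilpotent, (ad f)^(d+1) y = 0 and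
    f^(p+1) u = 0, then f^(p+dN) y^N u is a nonzero multiple of
    ((ad f)^d y)^N f^p u. *)
Require Import Defs.
From mathcomp Require Import all_boot all_order all_algebra.
From mathcomp Require Import reals.
From mathcomp.real_closed Require Import complex.
From mathcomp Require Import perm.
From mathcomp Require Import zify ring.
Import Order.TTheory GRing.Theory Num.Theory.
Local Open Scope ring_scope.

Set Implicit Arguments.
Unset Strict Implicit.
Unset Printing Implicit Defensive.

(** * Linear operators *)

Section LinearOperators.
Variables (R : realType) (V : lmodType R[i]).
Implicit Types (f g : V -> V) (x y z : V).

Lemma linD f : lin f -> {morph f : x y / x + y}.
Proof. by move=> lf x y; rewrite -[x]scale1r lf !scale1r. Qed.

Lemma lin0 f : lin f -> f 0 = 0.
Proof. by move=> lf; apply: (addrI (f 0)); rewrite -linD // !addr0. Qed.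

Lemma linZ f : lin f -> forall c x, f (c *: x) = c *: f x.
Proof. by move=> lf c x; rewrite -[c *: x]addr0 lf lin0 // addr0. Qed.

Lemma linN f : lin f -> forall x, f (- x) = - f x.
Proof. by move=> lf x; rewrite -scaleN1r linZ // scaleN1r. Qed.

Lemma linB f : lin f -> {morph f : x y / x - y}.
Proof. by move=> lf x y; rewrite linD // linN. Qed.

Lemma lin_iter f k : lin f -> lin (iter k f).
Proof. by move=> lf c x y; elim: k => //= k ->; rewrite lf. Qed.

Lemma iter_eq0 f : lin f -> forall k l x, (k <= l)%N -> iter k f x = 0 -> iter l f x = 0.
Proof.
by move=> lf k l x kl fx; rewrite -(subnK kl) iterD fx lin0 //; apply: lin_iter.
Qed.

Lemma first_kill f x k : x != 0 -> iter k f x = 0 ->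
  exists p, iter p f x != 0 /\ iter p.+1 f x = 0.
Proof.
elim: k => [|k IH] x0 /=; first by move=> x00; rewrite x00 eqxx in x0.
have [fk _|fk fk1] := eqVneq (iter k f x) 0; first exact: IH.
by exists k.
Qed.

(* [Y i] plays the role of [(ad f) ^ i (Y 0)]. *)
Section Leibniz.
Variables (f : V -> V) (d : nat) (Y : nat -> V -> V).
Hypotheses (lf : lin f) (lY : forall i, lin (Y i)).
Hypothesis fY : forall i x, f (Y i x) = Y i (f x) + Y i.+1 x.
Hypothesis Y_top : forall x, Y d.+1 x = 0.

Lemma leibniz_top e q x : (e <= d)%N -> iter q.+1 f x = 0 ->
  iter (q + e).+1 f (Y (d - e)%N x) = 0 /\
  exists2 c : nat, (0 < c)%N
    & iter (q + e) f (Y (d - e)%N x) = c%:R *: Y d (iter q f x).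
Proof.
have lfi k : lin (iter k f) by apply: lin_iter.
have Yd y : f (Y d y) = Y d (f y) by rewrite fY Y_top addr0.
have Ydi k y : iter k f (Y d y) = Y d (iter k f y).
  by elim: k => //= k ->; rewrite Yd.
elim: e q x => [|e IHe] q x led fq.
  rewrite addn0 subn0 !Ydi fq lin0 //; split=> //.
  by exists 1%N => //; rewrite scale1r.
have E : Y (d - e.+1).+1 = Y (d - e)%N by congr Y; lia.
have step y : f (Y (d - e.+1)%N y) = Y (d - e.+1)%N (f y) + Y (d - e)%N y.
  by rewrite fY E.
have led' := ltnW led.
elim: q x fq => [|q IHq] x fq.
  have [K [c c0 Hc]] := IHe 0%N x led' fq.
  have fx : f x = 0 by exact: fq.
  have st : f (Y (d - e.+1)%N x) = Y (d - e)%N x.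
    by rewrite step fx lin0 // add0r.
  rewrite !add0n in K Hc *; split; first by rewrite iterSr st.
  by exists c => //; rewrite iterSr st.
have fq' : iter q.+1 f (f x) = 0 by rewrite -iterSr.
have [K1 [c1 c10 Hc1]] := IHq _ fq'.
have [K2 [c2 c20 Hc2]] := IHe _ _ led' fq.
have e1 : (q.+1 + e.+1 = (q + e.+1).+1)%N by lia.
have e2 : (q + e.+1 = q.+1 + e)%N by lia.
rewrite e1; split.
  rewrite iterSr step (linD (lfi _)) K1 add0r e2.
  exact: K2.
exists (c1 + c2)%N; first by rewrite addn_gt0 c10.
rewrite iterSr step (linD (lfi _)) Hc1 e2 Hc2 natrD scalerDl.
by rewrite -(iterSr q f x).
Qed.

Lemma leibniz_kill q x : iter q f x = 0 -> exists k, iter k f (Y 0 x) = 0.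
Proof.
move=> fq; have fq1 : iter q.+1 f x = 0 by apply: iter_eq0 fq.
have [K _] := leibniz_top (leqnn d) fq1.
by rewrite subnn in K; exists (q + d).+1.
Qed.

(* [f ^ (p + d N) (Y 0) ^ N u] is a nonzero multiple of [(Y d) ^ N (f ^ p u)]. *)
Lemma leibniz_extremal u p N : iter p.+1 f u = 0 -> iter N (Y 0) u = 0 ->
  iter N (Y d) (iter p f u) = 0.
Proof.
move=> fp yN.
have lfi k : lin (iter k f) by apply: lin_iter.
suff [_ [c c0]] : iter (p + d * N).+1 f (iter N (Y 0) u) = 0 /\
    exists2 c : nat, (0 < c)%N
    & iter (p + d * N) f (iter N (Y 0) u) = c%:R *: iter N (Y d) (iter p f u).
  rewrite yN lin0 // => /esym/eqP; rewrite scaler_eq0 pnatr_eq0.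
  by case/orP=> [/eqP c00|/eqP //]; rewrite c00 in c0.
elim: {yN} N => [|N [K [c c0 IH]]].
  by rewrite muln0 addn0 fp; split=> //; exists 1%N => //=; rewrite scale1r.
have [K' [c' c'0 IH']] := leibniz_top (leqnn d) K.
rewrite subnn -addnA -mulnSr in K' IH'.
split=> //; exists (c' * c)%N; first by rewrite muln_gt0 c'0.
by rewrite iterS IH' IH linZ // scalerA natrM.
Qed.

End Leibniz.

Section Sl2.
Variables (e f : V -> V) (v : V) (a : R[i]).
Hypotheses (le : lin e) (lf : lin f).
Let h x := e (f x) - f (e x).
Hypothesis hf : forall x, h (f x) - f (h x) = - 2%:R *: f x.
Hypotheses (ev : e v = 0) (hv : h v = a *: v).

Lemma sl2_lower N : e (iter N.+1 f v) = (N.+1%:R * (a - N%:R)) *: iter N f v.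
Proof.
have hN k : h (iter k f v) = (a - 2%:R * k%:R) *: iter k f v.
  elim: k => [|k IH]; first by rewrite mulr0 subr0.
  rewrite iterS -[h _](subrK (f (h (iter k f v)))) hf IH linZ // -scalerDl.
  by congr (_ *: _); rewrite -natr1; ring.
elim: N => [|N IH].
  move: hv; rewrite /h ev (lin0 lf) subr0 /= => ->.
  by congr (_ *: _); ring.
rewrite iterS -[e _](subrK (f (e (iter N.+1 f v)))) -/(h _) hN IH linZ //.
rewrite -iterS -scalerDl; congr (_ *: _).
by rewrite -!natr1; ring.
Qed.

Lemma sl2_integral N : v != 0 -> iter N f v = 0 -> exists k : nat, a = k%:R.
Proof.
move=> v0 /(first_kill v0)[p [p0 p1]]; exists p; apply/eqP; rewrite -subr_eq0.
have := sl2_lower p; rewrite p1 lin0 // => /esym/eqP.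
by rewrite scaler_eq0 (negPf p0) orbF mulf_eq0 pnatr_eq0.
Qed.

End Sl2.
End LinearOperators.

(** * Matrices of sl(m+1|n) *)

Section Matrices.
Variables (R : realType) (m n : nat).
Local Notation N := (m + n).+1.
Local Notation Mx := 'M[R[i]]_N.
Local Notation E p q := (delta_mx p q : Mx).
Local Notation str := (str m n).
Local Notation in_g := (in_g m n).
Local Notation in_h := (in_h m n).
Local Notation homog := (homog m n).
Local Notation part := (part m n).
Implicit Types (a b h : Mx) (p q k l : 'I_N).

Lemma str_linear c a b : str (c *: a + b) = c * str a + str b.
Proof.
rewrite /Defs.str mulr_sumr -big_split /=; apply: eq_bigr => i _.
by rewrite !mxE; case: ifP => _ //; ring.
Qed.

Lemma strB a b : str (a - b) = str a - str b.
Proof. by rewrite addrC -scaleN1r str_linear mulN1r addrC. Qed.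

Lemma str0 : str (0 : Mx) = 0.
Proof. by rewrite -(subrr 0) strB subrr. Qed.

Lemma strZ c a : str (c *: a) = c * str a.
Proof. by rewrite -[c *: a]addr0 str_linear str0 addr0. Qed.

Lemma in_g_lin c a b : in_g a -> in_g b -> in_g (c *: a + b).
Proof. by rewrite /Defs.in_g str_linear => /eqP-> /eqP->; rewrite mulr0 addr0. Qed.

Lemma in_g0 : in_g (0 : Mx). Proof. by rewrite /Defs.in_g str0. Qed.

Lemma in_gD a b : in_g a -> in_g b -> in_g (a + b).
Proof. by move=> ga gb; rewrite -[a]scale1r in_g_lin. Qed.

Lemma in_gZ c a : in_g a -> in_g (c *: a).
Proof. by move=> ga; rewrite -[_ *: _]addr0 in_g_lin ?in_g0. Qed.

Lemma in_gB a b : in_g a -> in_g b -> in_g (a - b).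
Proof. by move=> ga gb; rewrite addrC -scaleN1r in_g_lin. Qed.

Lemma in_g_offdiag a : (forall p, a p p = 0) -> in_g a.
Proof.
move=> a0; rewrite /Defs.in_g /Defs.str big1 // => p _.
by rewrite a0 oppr0 if_same.
Qed.

Lemma in_g_delta p q : p != q -> in_g (E p q).
Proof.
move=> pq; apply: in_g_offdiag => k; rewrite mxE.
by have [->|//] := eqVneq k p; rewrite (negPf pq).
Qed.

Lemma in_h_g h : in_h h -> in_g h. Proof. by case/andP. Qed.

Lemma in_h_lin c a b : in_h a -> in_h b -> in_h (c *: a + b).
Proof.
case/andP=> da ga /andP[db gb]; rewrite /Defs.in_h in_g_lin // andbT.
apply/is_diag_mxP => i j ij.
by rewrite !mxE (is_diag_mxP da) // (is_diag_mxP db) // mulr0 addr0.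
Qed.

Lemma in_h0 : in_h (0 : Mx).
Proof. by rewrite /Defs.in_h in_g0 andbT; apply/is_diag_mxP => i j _; rewrite mxE. Qed.

Lemma homogP t a :
  reflect (forall p q, par p (+) par q != t -> a p q = 0) (part t a == a).
Proof.
apply: (iffP eqP) => [<- p q /negPf pq|H]; first by rewrite mxE pq.
by apply/matrixP => p q; rewrite mxE; case: eqP => // /eqP/H ->.
Qed.

Lemma homogI t a : (forall p q, par p (+) par q != t -> a p q = 0) -> homog t a.
Proof. by move=> /homogP/eqP. Qed.

Lemma homogE t a : homog t a -> forall p q, par p (+) par q != t -> a p q = 0.
Proof. by move=> /eqP/homogP. Qed.

Lemma homog_delta p q : homog (par p (+) par q) (E p q).
Proof.
apply: homogI => k l; rewrite mxE.
by have [->|//] := eqVneq k p; have [->|//] := eqVneq l q; rewrite eqxx.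
Qed.

Lemma homog_diag h : in_h h -> homog false h.
Proof.
case/andP=> /is_diag_mxP dh _; apply: homogI => k l.
have [->|kl _] := eqVneq k l; first by rewrite addbb.
by rewrite dh.
Qed.

Lemma homog_part t a : homog t (part t a).
Proof. by apply: homogI => k l /negPf kl; rewrite mxE kl. Qed.

Lemma part_sum a : a = part false a + part true a.
Proof.
by apply/matrixP => k l; rewrite !mxE; case: (_ (+) _); rewrite /= ?add0r ?addr0.
Qed.

Lemma in_g_part t a : in_g a -> in_g (part t a).
Proof.
case: t; first by move=> _; apply: in_g_offdiag => p; rewrite mxE addbb.
rewrite /Defs.in_g => /eqP ga; rewrite -[X in _ == X]ga; apply/eqP.
by apply: eq_bigr => p _; rewrite mxE addbb.
Qed.

Lemma str_mul a b :
  str (a *m b) = \sum_p \sum_q (-1) ^+ par p * (a p q * b q p).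
Proof.
apply: eq_bigr => p _; rewrite mxE -mulr_sumr.
by case: (par p); rewrite ?mulN1r ?mul1r.
Qed.

Lemma str_sbr s t a b : homog s a -> homog t b -> str (sbr m n s t a b) = 0.
Proof.
move=> ha hb; rewrite /sbr strB -[_ *: _]addr0 str_linear str0 addr0 !str_mul.
rewrite [X in _ - _ * X]exchange_big mulr_sumr -sumrB big1 // => p _.
rewrite mulr_sumr -sumrB big1 // => q _.
have [sE|/(homogE ha)->] := eqVneq (par p (+) par q) s; last by rewrite mulr0 mul0r !mulr0 subrr.
have [tE|/(homogE hb)->] := eqVneq (par q (+) par p) t; last by rewrite mulr0 mul0r !mulr0 subrr.
rewrite -sE -tE; case: (par p); case: (par q) => /=; ring.
Qed.

Lemma homog_sbr s t a b : homog s a -> homog t b -> homog (s (+) t) (sbr m n s t a b).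
Proof.
move=> ha hb; apply: homogI => p q pq; rewrite !mxE !big1 ?mulr0 ?subrr // => k _.
  have [sE|/(homogE hb)->] := eqVneq (par p (+) par k) t; last by rewrite mul0r.
  have [tE|/(homogE ha)->] := eqVneq (par k (+) par q) s; last by rewrite mulr0.
  by move: pq; rewrite -sE -tE; case: (par p); case: (par q); case: (par k).
have [sE|/(homogE ha)->] := eqVneq (par p (+) par k) s; last by rewrite mul0r.
have [tE|/(homogE hb)->] := eqVneq (par k (+) par q) t; last by rewrite mulr0.
by move: pq; rewrite -sE -tE; case: (par p); case: (par q); case: (par k).
Qed.

Lemma in_g_comm a b : in_g a -> homog false b -> in_g (b *m a - a *m b).
Proof.
move=> ga hb; apply/eqP; rewrite (part_sum a) mulmxDr mulmxDl opprD addrACA.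
have H t : str (b *m part t a - part t a *m b) = 0.
  by have := str_sbr hb (homog_part t a); rewrite /sbr expr0 scale1r.
by rewrite -[X in X + _]scale1r str_linear !H mulr0 addr0.
Qed.

Lemma mul_delta_l p q a k l : (E p q *m a) k l = if k == p then a q l else 0.
Proof.
rewrite mxE (bigD1 q) //= big1 ?addr0 => [|j jq].
  by rewrite mxE eqxx andbT; case: eqP => _; rewrite ?mul1r ?mul0r.
by rewrite mxE (negPf jq) andbF mul0r.
Qed.

Lemma mul_delta_r p q a k l : (a *m E p q) k l = if l == q then a k p else 0.
Proof.
rewrite mxE (bigD1 p) //= big1 ?addr0 => [|j jq].
  by rewrite mxE eqxx; case: eqP => _; rewrite ?mulr1 ?mulr0.
by rewrite mxE (negPf jq) mulr0.
Qed.

Lemma str_delta_l p q a : str (E p q *m a) = (-1) ^+ par p * a q p.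
Proof.
rewrite /Defs.str (bigD1 p) //= big1 => [|k kp].
  by rewrite addr0 mul_delta_l eqxx; case: (par p); rewrite ?mulN1r ?mul1r.
by rewrite mul_delta_l (negPf kp) oppr0 if_same.
Qed.

Lemma diag_comm_delta h p q : in_h h -> h *m E p q - E p q *m h = (h p p - h q q) *: E p q.
Proof.
case/andP=> /is_diag_mxP dh _; apply/matrixP => k l.
rewrite mxE [fun_of_matrix (- _) k l]mxE mul_delta_l mul_delta_r !mxE.
have [kp|kp] := eqVneq k p; have [lq|lq] := eqVneq l q; rewrite ?mulr1 ?mulr0 //.
- by rewrite kp lq.
- by rewrite dh 1?eq_sym // subr0.
- by rewrite dh // subr0.
- by rewrite subr0.
Qed.

Definition diag_part a : Mx := diag_mx (\row_p a p p).

Lemma in_h_diag_part a : in_g a -> in_h (diag_part a).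
Proof.
rewrite /Defs.in_h /Defs.in_g => /eqP ga; rewrite -[X in _ == X]ga.
rewrite diag_mx_is_diag /=; apply/eqP; apply: eq_bigr => p _.
by rewrite !mxE eqxx mulr1n.
Qed.

Lemma in_h_diagE h : in_h h -> diag_part h = h.
Proof.
case/andP=> /is_diag_mxP dh _; apply/matrixP => k l; rewrite !mxE.
by have [->|kl] := eqVneq k l; rewrite ?mulr1n // mulr0n dh.
Qed.

Definition upper (ps : 'I_N -> nat) a := forall p q, a p q != 0 -> (ps p < ps q)%N.

Lemma upper_diag ps a : upper ps a -> forall p, a p p = 0.
Proof. by move=> ua p; apply: contraTeq isT => /ua; rewrite ltnn. Qed.

Lemma in_g_upper ps a : upper ps a -> in_g a.
Proof. by move=> ua; apply: in_g_offdiag; apply: upper_diag ua. Qed.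

End Matrices.

(** * Singular vectors *)

Section GhatModule.
Variables (R : realType) (m n : nat).
Local Notation N := (m + n).+1.
Local Notation Mx := 'M[R[i]]_N.
Local Notation E p q := (delta_mx p q : Mx).
Local Notation str := (str m n).
Local Notation in_g := (in_g m n).
Local Notation in_h := (in_h m n).
Local Notation homog := (homog m n).
Local Notation part := (part m n).
Local Notation sbr := (sbr m n).
Variables (V : lmodType R[i]) (sigma : V -> V).
Variables (rho : Mx -> int -> V -> V) (rK rd : V -> V).
Hypothesis HV : ghat_module m n sigma rho rK rd.
Implicit Types (a b h : Mx) (p q k l : 'I_N) (x y u w : V).

Lemma rho_lin a r : in_g a -> lin (rho a r).
Proof. by case: HV => _ [H _] _ _ _; apply: H. Qed.

Lemma rK_lin : lin rK. Proof. by case: HV => _ [_ [H _]]. Qed.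

Lemma rd_lin : lin rd. Proof. by case: HV => _ [_ [_ H]]. Qed.

Lemma rho_linl r c a b x : in_g a -> in_g b ->
  rho (c *: a + b) r x = c *: rho a r x + rho b r x.
Proof. by case: HV => _ _ H _ _; apply: H. Qed.

Lemma rho0 r x : rho 0 r x = 0.
Proof.
have g0 := in_g0 R m n; have := rho_linl r (-1) x g0 g0.
by rewrite scaler0 addr0 scaleN1r addNr.
Qed.

Lemma rhoD r a b x : in_g a -> in_g b -> rho (a + b) r x = rho a r x + rho b r x.
Proof. by move=> ga gb; rewrite -[a]scale1r rho_linl ?scale1r. Qed.

Lemma rhoZ r c a x : in_g a -> rho (c *: a) r x = c *: rho a r x.
Proof. by move=> ga; rewrite -[c *: a]addr0 rho_linl ?in_g0 // rho0 addr0. Qed.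

Lemma rho_comm s t a b r r' x : in_g a -> in_g b -> homog s a -> homog t b ->
  rho a r (rho b r' x) = (-1) ^+ (s && t) *: rho b r' (rho a r x)
   + (rho (sbr s t a b) (r + r') x
      + (if r == - r' then r%:~R * str (a *m b) else 0) *: rK x).
Proof.
by case: HV => _ _ _ _ [H _ _ _] ga gb ha hb; rewrite -(H s t) // addrC subrK.
Qed.

Lemma rK_rho a r x : in_g a -> rK (rho a r x) = rho a r (rK x).
Proof. by case: HV => _ _ _ _ [_ H _ _]; apply: H. Qed.

Lemma rd_rho a r x : in_g a -> rd (rho a r x) = rho a r (rd x) + r%:~R *: rho a r x.
Proof. by case: HV => _ _ _ _ [_ _ _ H] ga; rewrite -H // addrC subrK. Qed.

Lemma rho_comm_even s r a b x : in_g a -> in_g b -> homog false b ->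
  rho b s (rho a r x) = rho a r (rho b s x)
   + (rho (b *m a - a *m b) (s + r) x
      + (if s == - r then s%:~R * str (b *m a) else 0) *: rK x).
Proof.
move=> ga gb hb.
have H t : rho b s (rho (part t a) r x) = rho (part t a) r (rho b s x)
   + (rho (b *m part t a - part t a *m b) (s + r) x
      + (if s == - r then s%:~R * str (b *m part t a) else 0) *: rK x).
  rewrite (rho_comm _ _ _ gb (in_g_part t ga) hb (homog_part t a)).
  by rewrite /sbr expr0 !scale1r.
have g t := in_g_part t ga.
have gc t := in_g_comm (g t) hb.
have aE y : rho a r y = rho (part false a) r y + rho (part true a) r y.
  by rewrite -rhoD // -part_sum.
have cE : b *m a - a *m b =
    (b *m part false a - part false a *m b) + (b *m part true a - part true a *m b).
  by rewrite addrACA -mulmxDr -opprD -mulmxDl -part_sum.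
have strE : str (b *m a) = str (b *m part false a) + str (b *m part true a).
  by rewrite {1}(part_sum a) mulmxDr -[X in str (X + _)]scale1r str_linear mul1r.
rewrite !aE (linD (rho_lin s gb)) !H cE (rhoD _ _ (gc _) (gc _)) strE.
rewrite [LHS]addrACA; congr (_ + _); rewrite [LHS]addrACA; congr (_ + _).
by rewrite -scalerDl; case: ifP => _; rewrite ?addr0 // mulrDr.
Qed.

Lemma rho_h_delta h p q s x : in_h h -> p != q ->
  rho h 0 (rho (E p q) s x) =
  rho (E p q) s (rho h 0 x) + (h p p - h q q) *: rho (E p q) s x.
Proof.
move=> hh pq; have gE := in_g_delta R pq.
rewrite rho_comm_even //; [|exact: in_h_g|exact: homog_diag].
rewrite diag_comm_delta // rhoZ // add0r mulr0z mul0r if_same scale0r addr0.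
by [].
Qed.

Lemma rho_root_ind (P : V -> Prop) a r x : in_g a ->
  P 0 -> (forall c y z, P y -> P z -> P (c *: y + z)) ->
  (forall p q, p != q -> a p q != 0 -> P (rho (E p q) r x)) ->
  P (rho (diag_part a) r x) -> P (rho a r x).
Proof.
move=> ga P0 PL PE Pd.
pose c p q := (a - diag_part a) p q.
have cE p q : c p q = if p == q then 0 else a p q.
  rewrite /c !mxE; have [->|_] := eqVneq p q; first by rewrite mulr1n subrr.
  by rewrite mulr0n subr0.
have gcE p q : in_g (c p q *: E p q).
  rewrite cE; case: eqVneq => [|pq]; first by rewrite scale0r in_g0.
  by rewrite in_gZ ?in_g_delta.
have PD y z : P y -> P z -> P (y + z).
  by move=> Py Pz; rewrite -[y]scale1r; apply: PL.
have aE : a = diag_part a + \sum_p \sum_q c p q *: E p q.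
  by rewrite -matrix_sum_delta addrC subrK.
suff [gS PS] : in_g (\sum_p \sum_q c p q *: E p q) /\
    P (rho (\sum_p \sum_q c p q *: E p q) r x).
  by rewrite aE (rhoD _ _ (in_h_g (in_h_diag_part ga)) gS); apply: PD.
pose Q b := in_g b /\ P (rho b r x).
have Q0 : Q 0 by split; rewrite ?in_g0 ?rho0.
have QD b b' : Q b -> Q b' -> Q (b + b').
  by move=> [gb Pb] [gb' Pb']; split; rewrite ?in_gD ?rhoD //; apply: PD.
apply: (big_ind Q) => // p _; apply: (big_ind Q) => // q _; split=> //.
rewrite cE; case: eqVneq => [|pq]; first by rewrite scale0r rho0.
have [->|apq] := eqVneq (a p q) 0; first by rewrite scale0r rho0.
rewrite rhoZ ?in_g_delta // -[_ *: _]addr0.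
by apply: PL => //; apply: PE.
Qed.

Definition singular (ps : 'I_N -> nat) w : Prop :=
  (forall p q, (ps p < ps q)%N -> rho (E p q) 0 w = 0) /\
  (forall a (r : int), in_g a -> 0 < r -> rho a r w = 0).

Lemma singular_upper ps w a : singular ps w -> upper ps a -> rho a 0 w = 0.
Proof.
move=> [sw _] ua; apply: (@rho_root_ind (fun y => y = 0)) => //; first exact: in_g_upper ua.
- by move=> c y z -> ->; rewrite scaler0 addr0.
- by move=> p q _ /ua/sw.
rewrite (_ : diag_part a = 0) ?rho0 //.
by apply/matrixP => k l; rewrite !mxE (upper_diag ua) mul0rn.
Qed.

Definition weight_vector w : Prop :=
  [/\ forall h, in_h h -> exists c, rho h 0 w = c *: w,
      exists c, rK w = c *: w & exists c, rd w = c *: w].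

Lemma weight_vector_delta p q s w : p != q ->
  weight_vector w -> weight_vector (rho (E p q) s w).
Proof.
move=> pq [Hh [cK HK] [cd Hd]]; have gE := in_g_delta R pq.
have lE := rho_lin s gE; split.
- move=> h hh; have [c Hc] := Hh h hh; exists (c + (h p p - h q q)).
  by rewrite rho_h_delta // Hc (linZ lE) -scalerDl.
- by exists cK; rewrite rK_rho // HK linZ.
- by exists (cd + s%:~R); rewrite rd_rho // Hd (linZ lE) -scalerDl.
Qed.

Lemma weight_vector_iter p q s w (j : nat) : p != q ->
  weight_vector w -> weight_vector (iter j (rho (E p q) s) w).
Proof. by move=> pq ww; elim: j => //= j IH; apply: weight_vector_delta. Qed.

Section Submodule.
Variables (ps : 'I_N -> nat) (w : V).
Hypotheses (ps_inj : injective ps) (ww : weight_vector w) (sw : singular ps w).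

Inductive lower_span : V -> Prop :=
| LSgen : lower_span w
| LS0 : lower_span 0
| LSlin c x y : lower_span x -> lower_span y -> lower_span (c *: x + y)
| LSneg t b s x : in_g b -> homog t b ->
    (s < 0 \/ s = 0 /\ exists p q, (ps q < ps p)%N /\ b = E p q) ->
    lower_span x -> lower_span (rho b s x).

Let LSZ c x : lower_span x -> lower_span (c *: x).
Proof. by move=> Sx; rewrite -[_ *: _]addr0; apply: LSlin LS0. Qed.

Let LSD x y : lower_span x -> lower_span y -> lower_span (x + y).
Proof. by move=> Sx Sy; rewrite -[x]scale1r; apply: LSlin. Qed.

(* Moving [a t^r] past the first letter of a word in the negative part leaves a
   commutator acting on a shorter word, so no control of that commutator is
   needed. *)
Lemma lower_span_stable x : lower_span x ->
  [/\ forall t a r, in_g a -> homog t a -> lower_span (rho a r x),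
      lower_span (rK x) & lower_span (rd x)].
Proof.
elim=> {x} [||c x y _ [rx Kx dx] _ [ry Ky dy]|t b s x gb hb bneg Sx [rx Kx dx]].
- have [Hh [cK HK] [cd Hd]] := ww.
  split; [|by rewrite HK; apply: LSZ LSgen|by rewrite Hd; apply: LSZ LSgen].
  move=> t a r ga ha; have [r0|r0|->] := ltgtP r 0.
  + by apply: LSneg LSgen => //; [exact: ha|left].
  + by rewrite sw.2 //; apply: LS0.
  apply: (@rho_root_ind lower_span) => //; [exact: LS0|exact: LSlin| |]; last first.
    have [c ->] := Hh _ (in_h_diag_part ga).
    exact: LSZ LSgen.
  move=> p q pq _; have [pq'|pq'|/ps_inj pq'] := ltngtP (ps p) (ps q).
  + by rewrite sw.1 //; apply: LS0.
  + apply: LSneg LSgen; [exact: in_g_delta|exact: homog_delta|].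
    by right; split=> //; exists p, q.
  by rewrite pq' eqxx in pq.
- split; [|by rewrite (lin0 rK_lin); apply: LS0|by rewrite (lin0 rd_lin); apply: LS0].
  by move=> t a r ga ha; rewrite (lin0 (rho_lin r ga)); apply: LS0.
- split; [|by rewrite rK_lin; apply: LSlin|by rewrite rd_lin; apply: LSlin].
  by move=> t a r ga ha; rewrite rho_lin //; apply: LSlin; [apply: rx ha|apply: ry ha].
split.
- move=> t' a r ga ha; rewrite (rho_comm _ _ _ ga gb ha hb).
  apply: LSD; first by apply/LSZ/(LSneg gb hb bneg)/(rx _ _ _ ga ha).
  apply: LSD; last exact: LSZ.
  apply: rx (homog_sbr ha hb).
  by apply/eqP; apply: str_sbr.
- by rewrite rK_rho //; apply: LSneg Kx; [|exact: hb|].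
rewrite rd_rho //; apply: LSD; last apply: LSZ; apply: LSneg bneg _ => //; exact: hb.
Qed.

Hypothesis Hirr : irreducible m n rho rK rd.

Lemma lower_span_full : w != 0 -> forall x, lower_span x.
Proof.
move=> w0; case: (Hirr LS0 LSlin) => //.
- move=> a r x ga /lower_span_stable[H _ _]; rewrite (part_sum a).
  by rewrite rhoD ?in_g_part //; apply: LSD; apply: H (homog_part _ _); apply: in_g_part.
- by move=> x /lower_span_stable[].
- by move=> x /lower_span_stable[].
by move=> /(_ _ LSgen) w00; rewrite w00 eqxx in w0.
Qed.

End Submodule.
End GhatModule.

Section EigenSpan.
Variables (R : realType) (V : lmodType R[i]) (D : V -> V) (c : R[i]).
Hypothesis lD : lin D.

Inductive eigen_span : V -> Prop :=
| ES0 : eigen_span 0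
| ESeigen (j : nat) x : D x = (c - j%:R) *: x -> eigen_span x
| ESlin a x y : eigen_span x -> eigen_span y -> eigen_span (a *: x + y).

Lemma eigen_span_lower (Y : V -> V) (a : nat) : lin Y ->
  (forall x, D (Y x) = Y (D x) - a%:R *: Y x) ->
  forall x, eigen_span x -> eigen_span (Y x).
Proof.
move=> lY DY x; elim=> {x} [|j x Dx|b x y _ Sx _ Sy].
- by rewrite lin0 //; apply: ES0.
- apply: (@ESeigen (j + a)); rewrite DY Dx (linZ lY) -scalerBl natrD.
  by rewrite opprD addrA.
by rewrite lY; apply: ESlin.
Qed.

Let G (j : nat) x := D x - (c - j%:R) *: x.

Let lG r : lin (fun x => foldr G x r).
Proof.
move=> a x y; elim: r => //= j r ->; rewrite /G lD scalerBr scalerDr opprD addrACA.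
by rewrite !scalerA (mulrC a).
Qed.

Let GC j r x : foldr G (G j x) r = G j (foldr G x r).
Proof.
elim: r => //= k r ->; move: (foldr G x r) => y.
rewrite /G !(linB lD) !(linZ lD) !scalerBr !scalerA (mulrC (c - k%:R)).
by rewrite -!addrA; congr (_ + _); rewrite !opprB addrCA [RHS]addrCA [- _ + _]addrC.
Qed.

Let GCC r r' x : foldr G (foldr G x r) r' = foldr G (foldr G x r') r.
Proof. by elim: r => //= j r <-; rewrite GC. Qed.

Lemma eigen_span_above (e : nat) x : (0 < e)%N ->
  eigen_span x -> D x = (c + e%:R) *: x -> x = 0.
Proof.
move=> e0 Sx Dx.
have [r Gr] : exists r, foldr G x r = 0.
  elim: Sx => {x Dx} [|j x Dx|a x y _ [r Gx] _ [r' Gy]].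
  - by exists [::].
  - by exists [:: j]; rewrite /= /G Dx subrr.
  exists (r ++ r'); rewrite foldr_cat (lG r') (lG r) Gy (lin0 (lG r)) addr0.
  by rewrite GCC Gx (lin0 (lG r')) scaler0.
have [k /eqP] : exists k : nat, k.+1%:R *: x = 0.
  suff [k E] : exists k : nat, foldr G x r = k.+1%:R *: x by exists k; rewrite -E.
  elim: r {Gr} => [|j r [k IH]]; first by exists 0%N; rewrite scale1r.
  exists ((e + j) * k.+1).-1.
  have -> : ((e + j) * k.+1).-1.+1 = ((e + j) * k.+1)%N by apply: prednK; lia.
  rewrite /= IH /G (linZ lD) Dx !scalerA -scalerBl natrM natrD.
  by congr (_ *: _); ring.
by rewrite scaler_eq0 pnatr_eq0 /= => /eqP.
Qed.

End EigenSpan.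

Section Degree.
Variables (R : realType) (m n : nat).
Local Notation N := (m + n).+1.
Local Notation Mx := 'M[R[i]]_N.
Local Notation E p q := (delta_mx p q : Mx).
Local Notation str := (str m n).
Local Notation in_g := (in_g m n).
Local Notation in_h := (in_h m n).
Local Notation ix := (@ix m n).

Lemma sum_even_odd (W : nmodType) (F : 'I_N -> W) :
  \sum_p F p = \sum_(i < m.+1) F (ix i) + \sum_(j < n) F (ix (m.+1 + j)).
Proof.
rewrite (@big_split_ord _ _ _ m.+1 n) /=; congr (_ + _); apply: eq_bigr => i _.
  by congr F; apply: val_inj; rewrite /= inordK //; have := ltn_ord i; lia.
by congr F; apply: val_inj; rewrite /= inordK //; have := ltn_ord i; lia.
Qed.

Lemma val_ix i : (i <= m + n)%N -> val (ix i) = i.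
Proof. exact: inordK. Qed.

Lemma str_even_odd (a : Mx) : str a =
  \sum_(i < m.+1) a (ix i) (ix i) - \sum_(j < n) a (ix (m.+1 + j)) (ix (m.+1 + j)).
Proof.
rewrite /Defs.str sum_even_odd -sumrN; congr (_ + _); apply: eq_bigr => i _.
  by rewrite /par val_ix ?ifF //; have := ltn_ord i; lia.
by rewrite /par val_ix ?ifT //; have := ltn_ord i; lia.
Qed.

(* A scalar matrix, of nonzero supertrace as [n < m + 1], corrects the supertrace. *)
Lemma degree_matrix (ps : 'I_N -> nat) : (n <= m)%N ->
  exists2 h : Mx, in_h h & forall p q, h p p - h q q = (ps q)%:R - (ps p)%:R.
Proof.
move=> nm; pose g : Mx := diag_mx (\row_p (ps p)%:R).
have s1 : str (1%:M : Mx) != 0.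
  rewrite str_even_odd; under eq_bigr do rewrite mxE eqxx.
  under [X in _ - X]eq_bigr do rewrite mxE eqxx.
  rewrite !sumr_const !card_ord -natrB; last by lia.
  by rewrite pnatr_eq0; lia.
exists ((str g / str 1%:M) *: 1%:M - g) => [|p q].
  rewrite /Defs.in_h; apply/andP; split.
    apply/is_diag_mxP => k l kl; rewrite !mxE.
    by rewrite (negPf (_ : k != l)) // !mulr0n mulr0 subr0.
  by rewrite /Defs.in_g strB strZ divfK // subrr.
by rewrite !mxE !eqxx !mulr1n; ring.
Qed.

Variables (V : lmodType R[i]) (sigma : V -> V).
Variables (rho : Mx -> int -> V -> V) (rK rd : V -> V).
Hypothesis HV : ghat_module m n sigma rho rK rd.
Hypothesis Hirr : irreducible m n rho rK rd.
Hypothesis nm : (n <= m)%N.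

Lemma singular_lower_eq0 (ps : 'I_N -> nat) v p q (s : int) (M : nat) :
  injective ps -> weight_vector rho rK rd v -> v != 0 -> p != q ->
  (s < 0 \/ s = 0 /\ (ps q < ps p)%N) -> (0 < M)%N ->
  singular rho ps (iter M (rho (E p q) s) v) -> iter M (rho (E p q) s) v = 0.
Proof.
move=> ps_inj wv v0 pq neg M0 sing.
have [hD hhD hDE] := degree_matrix ps nm.
(* [hD + T d] has a negative integral degree on each negative root vector. *)
pose T := (\max_k ps k).+1.
have psT k : (ps k < T)%N by rewrite ltnS leq_bigmax.
pose D x := rho hD 0 x + T%:R *: rd x.
have lD : lin D.
  move=> a x y; rewrite /D (rho_lin HV _ (in_h_g hhD)) (rd_lin HV).
  by rewrite !scalerDr addrACA !scalerA (mulrC a).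
have lrho r k l : k != l -> lin (rho (E k l) r).
  by move=> kl; apply: (rho_lin HV); apply: in_g_delta.
have DE k l r x : k != l -> D (rho (E k l) r x) =
    rho (E k l) r (D x) + ((ps l)%:R - (ps k)%:R + T%:R * r%:~R) *: rho (E k l) r x.
  move=> kl; rewrite /D (rho_h_delta HV) // hDE (rd_rho HV) ?in_g_delta //.
  rewrite (linD (lrho _ _ _ kl)) (linZ (lrho _ _ _ kl)) scalerDr scalerA addrACA.
  by rewrite -scalerDl.
have deg k l (r : int) : k != l -> (r < 0 \/ r = 0 /\ (ps l < ps k)%N) ->
    exists2 a : nat, (0 < a)%N &
      forall x, D (rho (E k l) r x) = rho (E k l) r (D x) - a%:R *: rho (E k l) r x.
  move=> kl Hr; exists (ps k + T * `|r| - ps l)%N.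
    by have := psT l; nia.
  move=> x; rewrite DE // -scaleNr; congr (_ + _ *: _).
  have rE : r = - (`|r|%N : int) by lia.
  rewrite natrB; last by have := psT l; nia.
  rewrite natrD natrM {1}rE mulrNz; ring.
have [cv Dv] : exists c, D v = c *: v.
  have [Hh _ [cd Hd]] := wv; have [ch Hch] := Hh _ hhD.
  by exists (ch + T%:R * cd); rewrite /D Hch Hd scalerDl scalerA.
have [a a0 Da] := deg _ _ _ pq neg.
set w := iter M _ v in sing *.
have Dw : D w = (cv - (M * a)%:R) *: w.
  rewrite /w; elim: (M) => [|k IH]; first by rewrite mul0n subr0.
  rewrite !iterS Da IH (linZ (lrho _ _ _ pq)) -scalerBl; congr (_ *: _).
  by rewrite mulSn natrD; ring.
have [//|w0] := eqVneq w 0.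
have ww : weight_vector rho rK rd w by apply: (weight_vector_iter HV).
have Sv := lower_span_full HV ps_inj ww sing Hirr w0 v.
pose c := cv - (M * a)%:R.
suff ESv : eigen_span D c v.
  have v00 : v = 0.
    apply: (eigen_span_above (e := (M * a)%N) lD _ ESv); first by rewrite muln_gt0 M0.
    by rewrite Dv subrK.
  by rewrite v00 eqxx in v0.
elim: Sv => [||a' x y _ Sx _ Sy|t b r x gb hb Hb _ Sx].
- by apply: (@ESeigen _ _ _ _ 0%N); rewrite subr0.
- exact: ES0.
- exact: ESlin.
apply: (rho_root_ind HV) => //; [exact: ES0|exact: ESlin| |].
  move=> k l kl bkl; have [|d d0 Dd] := deg k l r kl.
    case: Hb => [|[r0 [k' [l' [psl bE]]]]]; [by left|right; split=> //].
    move: bkl; rewrite bE !mxE; have [->|_] := eqVneq k k'; last by rewrite eqxx.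
    by have [->//|_] := eqVneq l l'; rewrite eqxx.
  by apply: eigen_span_lower Dd _ Sx; apply: lrho.
have hdb := in_h_diag_part gb.
have ldb r' := rho_lin HV r' (in_h_g hdb).
case: Hb => [r0|[r0 [k' [l' [psl bE]]]]]; last first.
  rewrite (_ : diag_part b = 0) ?(rho0 HV); first exact: ES0.
  have kl' : (k' == l') = false by apply: contraTF psl => /eqP->; rewrite ltnn.
  apply/matrixP => i j; rewrite bE !mxE.
  by have [->|_] := eqVneq i k'; rewrite ?kl' mul0rn.
apply: (eigen_span_lower (a := T * `|r|)) => // x'.
rewrite /D (rho_comm_even HV) ?in_h_g //; last exact: homog_diag.
have -> : hD *m diag_part b - diag_part b *m hD = 0.
  by rewrite -(in_h_diagE hhD) /diag_part !mulmx_diag; apply/eqP; rewrite subr_eq0;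
     apply/eqP; congr diag_mx; apply/rowP => k; rewrite !mxE mulrC.
rewrite (rho0 HV) mulr0z mul0r if_same scale0r !addr0.
rewrite (rd_rho HV) ?in_h_g // (linD (ldb r)) (linZ (ldb r)) scalerDr addrA.
congr (_ + _); rewrite scalerA -scaleNr; congr (_ *: _).
have rE : r = - (`|r|%N : int) by lia.
by rewrite natrM {1}rE mulrNz mulrN.
Qed.

End Degree.

(** * Local nilpotency *)

Section Nilpotent.
Variables (R : realType) (m n : nat).
Local Notation N := (m + n).+1.
Local Notation Mx := 'M[R[i]]_N.
Local Notation E p q := (delta_mx p q : Mx).
Local Notation str := (str m n).
Local Notation in_g := (in_g m n).
Local Notation ix := (@ix m n).
Variables (V : lmodType R[i]) (sigma : V -> V).
Variables (rho : Mx -> int -> V -> V) (rK rd : V -> V).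
Hypothesis HV : ghat_module m n sigma rho rK rd.
Hypothesis Hirr : irreducible m n rho rK rd.
Implicit Types (p q t : 'I_N).

Lemma homog_even p q : par p = false -> par q = false -> homog m n false (E p q).
Proof. by move=> pe qe; have := homog_delta R p q; rewrite pe qe. Qed.

Section RootVector.
Variables (p q : 'I_N) (s : int).
Hypotheses (pe : par p = false) (qe : par q = false) (pq : p != q).
Local Notation b := (E p q).
Local Notation f := (rho b s).

Let gb : in_g b. Proof. exact: in_g_delta. Qed.
Let hb : homog m n false b. Proof. exact: homog_even. Qed.
Let lf : lin f. Proof. exact: (rho_lin HV). Qed.

Definition ad_mx (a : Mx) i : Mx := iter i (fun a => b *m a - a *m b) a.

Definition ad_K (a : Mx) (r : int) i : R[i] :=
  if i is j.+1 then
    if s == - (s *+ j + r) then s%:~R * str (b *m ad_mx a j) else 0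
  else 0.

Definition ad_op (a : Mx) (r : int) i (x : V) : V :=
  rho (ad_mx a i) (s *+ i + r) x + ad_K a r i *: rK x.

Lemma in_g_ad a i : in_g a -> in_g (ad_mx a i).
Proof. by move=> ga; elim: i => //= i IH; apply: in_g_comm. Qed.

Lemma ad_op_lin a r i : in_g a -> lin (ad_op a r i).
Proof.
move=> ga c x y; rewrite /ad_op (rho_lin HV _ (in_g_ad i ga)) (rK_lin HV).
by rewrite !scalerDr addrACA !scalerA (mulrC c (ad_K _ _ _)).
Qed.

Lemma ad_op_comm a r i x : in_g a ->
  f (ad_op a r i x) = ad_op a r i (f x) + ad_op a r i.+1 x.
Proof.
move=> ga; rewrite /ad_op (linD lf) (linZ lf).
rewrite (rho_comm_even HV) // ?in_g_ad // -(rK_rho HV) //.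
by rewrite [RHS]addrAC [s *+ i.+1]mulrS -[s + _ + r]addrA.
Qed.

Lemma mul_bab a : b *m a *m b = a q p *: b.
Proof.
apply/matrixP => k l; rewrite mul_delta_r mul_delta_l !mxE.
by case: (l == q); case: (k == p); rewrite ?mulr1 ?mulr0.
Qed.

Lemma mul_bb : b *m b = 0.
Proof. by rewrite mul_delta_mx_0 // eq_sym. Qed.

Lemma ad_mx2 a : ad_mx a 2 = (- 2%:R * a q p) *: b.
Proof.
rewrite /ad_mx /= mulmxBr mulmxBl !mulmxA mul_bb mul0mx sub0r.
rewrite -!mulmxA mul_bb mulmx0 subr0 !mulmxA mul_bab -opprD -scalerDl -scaleNr.
by congr (_ *: _); ring.
Qed.

Lemma ad_op2 a r x : ad_op a r 2 x = (- 2%:R * a q p) *: rho b (s *+ 2 + r) x.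
Proof.
rewrite /ad_op ad_mx2 (rhoZ HV) // /ad_K [ad_mx a 1]/= mulmxBr mulmxA mul_bb.
rewrite mul0mx sub0r mulmxA mul_bab -scaleNr strZ.
by rewrite (eqP gb) !mulr0 if_same scale0r addr0.
Qed.

Lemma ad_op3 a r x : ad_op a r 3 x = 0.
Proof.
rewrite /ad_op /ad_K.
have -> : ad_mx a 3 = 0.
  by rewrite /ad_mx iterS -/(ad_mx a 2) ad_mx2 -scalemxAr -scalemxAl mul_bb subrr.
by rewrite ad_mx2 -scalemxAr mul_bb scaler0 str0 mulr0 if_same scale0r (rho0 HV) addr0.
Qed.

(* The vectors killed by a power of [f] form a submodule because
   [ad f] is nilpotent on the affine algebra. *)
Lemma loc_nilpotent_vector u k : u != 0 -> iter k f u = 0 -> loc_nilpotent f.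
Proof.
move=> u0 fu; pose W x := exists j : nat, iter j f x = 0.
have lfi j : lin (iter j f) by apply: lin_iter.
have Weq0 j l x : (j <= l)%N -> iter j f x = 0 -> iter l f x = 0 by apply: iter_eq0.
case: (Hirr (W := W)) => //.
- by exists 0%N.
- move=> c x y [i fx] [j fy]; exists (maxn i j).
  by rewrite lfi (Weq0 i) ?leq_maxl // (Weq0 j) ?leq_maxr // scaler0 addr0.
- move=> a r x ga [j fx].
  have Y0 y : ad_op a r 0 y = rho a r y by rewrite /ad_op /= add0r scale0r addr0.
  have [j' Hj'] := leibniz_kill lf (fun i => ad_op_lin r i ga)
    (fun i y => ad_op_comm r i y ga) (ad_op3 a r) fx.
  by exists j'; rewrite -Y0.
- move=> x [j fx]; exists j.
  have -> : iter j f (rK x) = rK (iter j f x).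
    by elim: (j) => //= i ->; rewrite (rK_rho HV).
  by rewrite fx (lin0 (rK_lin HV)).
- move=> x [j fx]; exists j.
  have -> : iter j f (rd x) = rd (iter j f x) - (s *+ j)%:~R *: iter j f x.
    elim: (j) => [|i IH]; first by rewrite mulr0n scale0r subr0.
    rewrite !iterS IH (linB lf) (linZ lf) (rd_rho HV) // mulrS intrD scalerDl opprD.
    by rewrite addrA addrK.
  by rewrite fx (lin0 (rd_lin HV)) scaler0 subr0.
by move=> /(_ u) H; rewrite H ?eqxx in u0; last exists k.
Qed.

End RootVector.

Lemma nilpotent_bracket p q t s r :
  par p = false -> par q = false -> par t = false ->
  p != q -> q != t -> p != t -> (exists u : V, u != 0) ->
  loc_nilpotent (rho (E p q) s) -> loc_nilpotent (rho (E q t) r) ->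
  loc_nilpotent (rho (E p t) (s + r)).
Proof.
move=> pe qe te pq qt pt [u u0] nf ny.
have [gpq gqt gpt] : [/\ in_g (E p q), in_g (E q t) & in_g (E p t)].
  by split; apply: in_g_delta.
have lf := rho_lin HV s gpq; have lpt := rho_lin HV (s + r) gpt.
have [N' yN] := ny u; have [k fk] := nf u; have [j [fj fj1]] := first_kill u0 fk.
apply: (loc_nilpotent_vector pe te pt fj (k := N')).
pose Y i := match i with 0 => rho (E q t) r | 1 => rho (E p t) (s + r) | _ => fun=> 0 end.
apply: (leibniz_extremal (d := 1) (Y := Y) lf) fj1 yN => //.
  by case=> [|[|i]]; [exact: (rho_lin HV _ gqt)|exact: lpt|move=> c x y; rewrite scaler0 addr0].
have hf := homog_even pe qe.
case=> [|[|i]] x /=; last by rewrite (lin0 lf) addr0.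
  rewrite (rho_comm_even HV) // mul_delta_mx mul_delta_mx_0 1?eq_sym // subr0.
  by rewrite (eqP gpt) mulr0 if_same scale0r addr0.
rewrite (rho_comm_even HV) // mul_delta_mx_0 1?eq_sym // mul_delta_mx_0 1?eq_sym //.
by rewrite subr0 str0 mulr0 if_same scale0r (rho0 HV) addr0.
Qed.

Lemma nilpotent_reflection p q s r : par p = false -> par q = false -> p != q ->
  (exists u : V, u != 0) ->
  loc_nilpotent (rho (E p q) s) -> loc_nilpotent (rho (E q p) r) ->
  loc_nilpotent (rho (E p q) (s *+ 2 + r)).
Proof.
move=> pe qe pq [u u0] nf ny.
have [gpq gqp] : in_g (E p q) /\ in_g (E q p) by split; rewrite in_g_delta // eq_sym.
have lf := rho_lin HV s gpq; have lg := rho_lin HV (s *+ 2 + r) gpq.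
have [N' yN] := ny u; have [k fk] := nf u; have [j [fj fj1]] := first_kill u0 fk.
apply: (loc_nilpotent_vector pe qe pq fj (k := N')).
have Y0 x : ad_op p q s (E q p) r 0 x = rho (E q p) r x.
  by rewrite /ad_op /= add0r scale0r addr0.
have yN' : iter N' (ad_op p q s (E q p) r 0) u = 0 by rewrite (eq_iter Y0).
have lY i : lin (ad_op p q s (E q p) r i) by apply: ad_op_lin.
have fY i x : rho (E p q) s (ad_op p q s (E q p) r i x) =
    ad_op p q s (E q p) r i (rho (E p q) s x) + ad_op p q s (E q p) r i.+1 x.
  exact: ad_op_comm.
have Y3 x : ad_op p q s (E q p) r 3 x = 0 by apply: ad_op3.
have := leibniz_extremal lf lY fY Y3 fj1 yN'.
have -> : forall x, iter N' (ad_op p q s (E q p) r 2) x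
    = (- 2%:R) ^+ N' *: iter N' (rho (E p q) (s *+ 2 + r)) x.
  move=> x; elim: (N') => [|i IH]; first by rewrite scale1r.
  rewrite !iterS IH ad_op2 // mxE !eqxx mulr1 (linZ lg) scalerA exprS.
  by [].
move/eqP; rewrite scaler_eq0 expf_eq0 oppr_eq0 pnatr_eq0 andbF /=.
by move/eqP.
Qed.

Lemma integrable_of_simple (v : V) : v != 0 ->
  (forall i j, (i < j <= m)%N -> rho (E (ix i) (ix j)) 0 v = 0) ->
  (forall i, (i < m)%N -> loc_nilpotent (rho (E (ix i.+1) (ix i)) 0)) ->
  ((0 < m)%N -> loc_nilpotent (rho (E (ix 0) (ix m)) (- 1))) ->
  integrable m n rho.
Proof.
move=> v0 pos0 simple simple0.
have ex_u : exists u : V, u != 0 by exists v.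
have ev i : (i <= m)%N -> par (ix i) = false.
  by move=> im; rewrite /par val_ix ?ifF //; lia.
have neq i j : (i <= m)%N -> (j <= m)%N -> i <> j -> ix i != ix j.
  move=> im jm ij; apply/eqP => /(congr1 val); rewrite !val_ix; lia.
pose L i j r := loc_nilpotent (rho (E (ix i) (ix j)) r).
have brk i j l s r : (i <= m)%N -> (j <= m)%N -> (l <= m)%N -> i <> j -> j <> l -> i <> l ->
    L i j s -> L j l r -> L i l (s + r).
  by move=> im jm lm ij jl il; apply: nilpotent_bracket; auto.
have refl i j s r : (i <= m)%N -> (j <= m)%N -> i <> j ->
    L i j s -> L j i r -> L i j (s *+ 2 + r).
  by move=> im jm ij; apply: nilpotent_reflection; auto.
have Lup i j : (i < j <= m)%N -> L i j 0.
  move=> ij; apply: (@loc_nilpotent_vector _ _ _ _ _ _ v 1) => //; try (apply: ev; lia).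
    by apply: neq; lia.
  exact: pos0.
have Llow d i : (i + d.+1 <= m)%N -> L (i + d.+1)%N i 0.
  elim: d i => [|d IH] i im; first by rewrite addn1; apply: simple; lia.
  rewrite addnS -[0]addr0; apply: (brk _ (i + d.+1)%N); try lia.
    by apply: simple; lia.
  by apply: IH; lia.
have L0 i j : (i <= m)%N -> (j <= m)%N -> i <> j -> L i j 0.
  move=> im jm ij; have [lt|lt|//] := ltngtP i j; first by apply: Lup; lia.
  have -> : i = (j + (i - j).-1.+1)%N by lia.
  by apply: Llow; lia.
have L1m i : (i < m)%N -> L i m (- 1).
  case: i => [|i] im; first by apply: simple0; lia.
  rewrite -[- 1]add0r; apply: (brk _ 0%N); try lia; first by apply: L0; lia.
  by apply: simple0; lia.
have L1lt i j : (i < j <= m)%N -> L i j (- 1).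
  move=> ij; have [->|jm] := eqVneq j m; first by apply: L1m; lia.
  by rewrite -[- 1]addr0; apply: (brk _ m); try lia; [apply: L1m; lia|apply: L0; lia].
have L1 i j : (i <= m)%N -> (j <= m)%N -> i <> j -> L i j (- 1).
  move=> im jm ij; have [lt|lt|//] := ltngtP i j; first by apply: L1lt; lia.
  rewrite -[- 1]add0r -[0](mul0rn _ 2).
  by apply: refl => //; [apply: L0|apply: L1lt; lia].
have Lr (r : nat) : forall i j, (i <= m)%N -> (j <= m)%N -> i <> j ->
    L i j (- (r : int)) /\ L i j (- (r.+1 : int)).
  elim: r => [|r IH] i j im jm ij; first by split; [apply: L0|apply: L1].
  have [_ H1] := IH _ _ im jm ij; split=> //.
  have -> : - (r.+2 : int) = (- 1) *+ 2 + (- (r : int)) by lia.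
  by apply: refl => //; [apply: L1|apply: (IH j i _ _ _).1; auto].
have ixK (i : 'I_N) : ix (val i) = i by apply: val_inj; rewrite val_ix // -ltnS ltn_ord.
split=> [i j ij|i j im jm ij r r0].
  by rewrite -(ixK i) -(ixK j); apply: L0; rewrite /=; lia.
have -> : r = (`|r|%N : int) by lia.
rewrite -(ixK i) -(ixK j); apply: (Lr _ _ _ _ _ _).1 => // e.
by case/eqP: ij; apply: val_inj.
Qed.

End Nilpotent.

(** * Simple roots *)

Section HighestWeight.
Variables (R : realType) (m n : nat).
Local Notation N := (m + n).+1.
Local Notation Mx := 'M[R[i]]_N.
Local Notation E p q := (delta_mx p q : Mx).
Local Notation str := (str m n).
Local Notation in_g := (in_g m n).
Local Notation in_h := (in_h m n).
Local Notation ix := (@ix m n).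
Variables (V : lmodType R[i]) (sigma : V -> V).
Variables (rho : Mx -> int -> V -> V) (rK rd : V -> V).
Hypothesis HV : ghat_module m n sigma rho rK rd.
Implicit Types (p q : 'I_N) (a h : Mx) (ps : 'I_N -> nat).

Lemma in_h_coroot p q : par p = false -> par q = false -> in_h (E q q - E p p).
Proof.
move=> pe qe; apply/andP; split.
  have diagE j k l : k != l -> E j j k l = 0.
    by rewrite mxE; case: andP => // -[/eqP-> /eqP->]; rewrite eqxx.
  by apply/is_diag_mxP => k l kl; rewrite mxE [fun_of_matrix (- _) _ _]mxE !diagE // subrr.
have strE k : par k = false -> str (E k k) = 1.
  move=> ke; rewrite -(mul_delta_mx k k) str_delta_l ke expr0 mul1r.
  by rewrite mxE !eqxx.
by rewrite /Defs.in_g strB !strE // subrr.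
Qed.

Section RootSl2.
Variables (p q : 'I_N) (s : int).
Hypotheses (pe : par p = false) (qe : par q = false) (pq : p != q).
Local Notation f := (rho (E p q) s).
Local Notation e := (rho (E q p) (- s)).

Let gpq : in_g (E p q). Proof. exact: in_g_delta. Qed.
Let gqp : in_g (E q p). Proof. by apply: in_g_delta; rewrite eq_sym. Qed.

Lemma root_coroot x : e (f x) - f (e x) = rho (E q q - E p p) 0 x - s%:~R *: rK x.
Proof.
rewrite (rho_comm_even HV) //; last exact: homog_even.
rewrite addrAC subrr add0r !mul_delta_mx addNr eqxx -(mul_delta_mx q q).
by rewrite str_delta_l mxE !eqxx qe mul1r mulr1 mulrNz scaleNr.
Qed.

Lemma root_coroot_comm x :
  (e (f (f x)) - f (e (f x))) - f (e (f x) - f (e x)) = - 2%:R *: f x.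
Proof.
have lf := rho_lin HV s gpq.
rewrite !root_coroot (linB lf) (linZ lf) (rho_h_delta HV) //; last exact: in_h_coroot.
rewrite -(rK_rho HV) // opprB addrA subrK addrAC subrr add0r.
congr (_ *: _); rewrite !mxE !eqxx [q == p]eq_sym (negPf pq) /=.
by rewrite mulr0n mulr1n; ring.
Qed.

Lemma kill_lower (P : Mx -> int -> Prop) v k :
  (forall a r, P a r -> in_g a) ->
  (forall a r, P a r -> P (E p q *m a - a *m E p q) (s + r)) ->
  (forall a r, P a r -> s = - r -> s%:~R * str (E p q *m a) = 0) ->
  (forall a r, P a r -> rho a r v = 0) ->
  forall a r, P a r -> rho a r (iter k f v) = 0.
Proof.
move=> Pg Pad Pstr Pv; elim: k => [|k IH] a r Par /=; first exact: Pv Par.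
have := rho_comm_even HV s r (iter k f v) (Pg _ _ Par) gpq (homog_even _ pe qe).
rewrite IH // (lin0 (rho_lin HV _ gpq)) (IH _ _ (Pad _ _ Par)) add0r.
by case: eqP => [/(Pstr _ _ Par)->|_]; rewrite scale0r addr0.
Qed.

Hypothesis Hirr : irreducible m n rho rK rd.
Hypothesis nm : (n <= m)%N.

(* [f ^ (k + 1) v] is again singular, hence zero, when [k] is the coroot
   eigenvalue; [P] describes the positive part without the root vector [e]. *)
Lemma simple_root_kill ps (P : Mx -> int -> Prop) v (k : nat) :
  injective ps -> weight_vector rho rK rd v -> v != 0 -> singular rho ps v ->
  (s < 0 \/ s = 0 /\ (ps q < ps p)%N) ->
  (forall a r, P a r -> in_g a) ->
  (forall a r, P a r -> P (E p q *m a - a *m E p q) (s + r)) ->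
  (forall a r, P a r -> s = - r -> s%:~R * str (E p q *m a) = 0) ->
  (forall a r, P a r -> rho a r v = 0) ->
  (forall w, (forall a r, P a r -> rho a r w = 0) -> e w = 0 -> singular rho ps w) ->
  e v = 0 -> rho (E q q - E p p) 0 v - s%:~R *: rK v = k%:R *: v ->
  iter k.+1 f v = 0.
Proof.
move=> ps_inj wv v0 sv neg Pg Pad Pstr Pv Psing ev hv.
apply: (singular_lower_eq0 HV Hirr nm ps_inj) => //; apply: Psing.
  exact: kill_lower.
have lf := rho_lin HV s gpq.
rewrite (sl2_lower lf root_coroot_comm ev (a := k%:R)).
  by rewrite subrr mulr0 scale0r.
by rewrite root_coroot.
Qed.

Lemma simple_root_integral v (c : R[i]) j : v != 0 -> e v = 0 ->
  rho (E q q - E p p) 0 v - s%:~R *: rK v = c *: v ->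
  iter j f v = 0 -> exists k : nat, c = k%:R.
Proof.
move=> v0 ev hv fv.
have le := rho_lin HV (- s) gqp; have lf := rho_lin HV s gpq.
apply: (sl2_integral le lf root_coroot_comm ev _ v0 fv).
by rewrite root_coroot.
Qed.

End RootSl2.

Section SimpleRoots.
Hypothesis Hirr : irreducible m n rho rK rd.
Hypothesis nm : (n <= m)%N.
Variables (ps : 'I_N -> nat) (v : V).
Hypotheses (ps_inj : injective ps) (wv : weight_vector rho rK rd v) (v0 : v != 0).
Hypothesis sv : singular rho ps v.

Lemma finite_simple_root_kill p q (k : nat) : par p = false -> par q = false ->
  ps p = (ps q).+1 -> rho (E q q - E p p) 0 v = k%:R *: v ->
  iter k.+1 (rho (E p q) 0) v = 0.
Proof.
move=> pe qe adj hv.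
have pq : p != q by apply/eqP => e; rewrite e in adj; lia.
pose P a (r : int) := in_g a /\ (0 < r \/ r = 0 /\ upper ps a /\ a q p = 0).
apply: (@simple_root_kill p q 0 pe qe pq Hirr nm ps P) => //.
- by right; split=> //; rewrite adj.
- by move=> a r [].
- move=> a r [ga Ha]; split; first by apply: in_g_comm => //; apply: homog_even.
  rewrite add0r; case: Ha => [|[-> [ua aqp]]]; [by left|right; split=> //].
  have qp : (q == p) = false by rewrite eq_sym (negPf pq).
  split; last first.
    by rewrite mxE [fun_of_matrix (- _) _ _]mxE mul_delta_l mul_delta_r qp [p == q]eq_sym qp subrr.
  move=> k' l; rewrite mxE [fun_of_matrix (- _) _ _]mxE mul_delta_l mul_delta_r.
  have [->|k'p] := eqVneq k' p; have [->|lq] := eqVneq l q; rewrite ?sub0r ?subr0 ?oppr_eq0.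
  + by rewrite (upper_diag ua) (upper_diag ua) subrr eqxx.
  + move=> aql; have := ua _ _ aql; rewrite adj.
    have : ps l != ps p; last by rewrite adj; lia.
    by apply: contraNneq aql => /ps_inj->; rewrite aqp.
  + move=> akp; have := ua _ _ akp; rewrite adj.
    have : ps k' != ps q; last by lia.
    by apply: contraNneq akp => /ps_inj->; rewrite aqp.
  by rewrite eqxx.
- by move=> a r _ _; rewrite mulr0z mul0r.
- by move=> a r [ga [r0|[-> [ua _]]]]; [apply: sv.2|apply: (singular_upper HV) sv ua].
- move=> w Pw ew; split=> [k' l kl|a r ga r0]; last by apply: Pw; split=> //; left.
  have [/andP[/eqP-> /eqP->]|ne] := boolP ((k' == q) && (l == p)); first by move: ew; rewrite oppr0.
  apply: Pw; split.
    by apply: in_g_delta; apply/eqP => e; rewrite e ltnn in kl.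
  right; split=> //; split=> [i j|]; rewrite mxE.
    have [->|_] := eqVneq i k'; have [->|_] := eqVneq j l; rewrite ?eqxx //.
  by move: ne; rewrite [q == _]eq_sym [p == _]eq_sym => /negPf->.
- by rewrite oppr0; apply: sv.1; rewrite adj.
by rewrite mulr0z scale0r subr0.
Qed.

Lemma affine_simple_root_kill p q (k : nat) : par p = false -> par q = false -> p != q ->
  (forall l, (ps p <= ps l <= ps q)%N) ->
  rho (E q q - E p p) 0 v + rK v = k%:R *: v ->
  iter k.+1 (rho (E p q) (- 1)) v = 0.
Proof.
move=> pe qe pq ext hv.
have gqp : in_g (E q p) by apply: in_g_delta; rewrite eq_sym.
pose P a (r : int) := in_g a /\ [\/ 1 < r, r = 1 /\ a q p = 0, r = 0 /\ upper ps a | a = 0].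
apply: (@simple_root_kill p q (- 1) pe qe pq Hirr nm ps P) => //.
- by left.
- by move=> a r [].
- move=> a r [ga Ha]; split; first by apply: in_g_comm => //; apply: homog_even.
  case: Ha => [r1|[-> aqp]|[-> ua]|->]; last by constructor 4; rewrite mulmx0 mul0mx subrr.
  + have [r2|r2] : 1 < - 1 + r \/ r = 2 by lia.
      by constructor 1.
    constructor 2; split; first by rewrite r2.
    rewrite mxE [fun_of_matrix (- _) _ _]mxE mul_delta_l mul_delta_r.
    by rewrite [q == p]eq_sym (negPf pq) subrr.
  + constructor 3; split=> // k' l.
    rewrite mxE [fun_of_matrix (- _) _ _]mxE mul_delta_l mul_delta_r.
    have ps_lt i j : i != j -> (ps i <= ps j)%N -> (ps i < ps j)%N.
      by move=> ij; rewrite leq_eqVlt => /orP[/eqP/ps_inj e|//]; rewrite e eqxx in ij.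
    have [->|k'p] := eqVneq k' p; have [->|lq] := eqVneq l q => H.
    * by apply: ps_lt => //; case/andP: (ext q).
    * apply: ps_lt; last by case/andP: (ext l).
      by apply: contraNneq H => <-; rewrite aqp subrr.
    * apply: ps_lt; last by case/andP: (ext k').
      by apply: contraNneq H => ->; rewrite aqp subrr.
    by rewrite subrr eqxx in H.
  constructor 4; apply/matrixP => k' l; rewrite mxE [fun_of_matrix (- _) _ _]mxE mul_delta_l mul_delta_r mxE.
  have -> : a q l = 0.
    by apply: contraTeq isT => /ua; case/andP: (ext l); lia.
  have -> : a k' p = 0.
    by apply: contraTeq isT => /ua; case/andP: (ext k'); lia.
  by rewrite !if_same subrr.
- move=> a r [ga Ha] /eqP; rewrite eqr_opp => /eqP r1.
  rewrite str_delta_l; case: Ha => [|[_ ->]|[]|->]; rewrite -?r1 ?mxE ?mulr0 //.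
- by move=> a r [ga [r0|[-> _]|[-> ua]|->]]; [apply: sv.2 => //; lia|exact: sv.2|apply: (singular_upper HV) sv ua|exact: (rho0 HV)].
- move=> w Pw; rewrite opprK => ew; split=> [k' l kl|a r ga r0].
    apply: Pw; split.
      by apply: in_g_delta; apply/eqP => e; rewrite e ltnn in kl.
    constructor 3; split=> // i j; rewrite mxE.
    by have [->|_] := eqVneq i k'; have [->|_] := eqVneq j l; rewrite ?eqxx.
  have [r1|->] : 1 < r \/ r = 1 by lia.
    by apply: Pw; split=> //; constructor 1.
  have gc := in_gZ (a q p) gqp.
  rewrite -(subrK (a q p *: E q p) a) (rhoD HV _ _ (in_gB ga gc) gc).
  rewrite (rhoZ HV) // ew scaler0 addr0; apply: Pw; split; first exact: in_gB.
  by constructor 2; split=> //; rewrite !mxE !eqxx mulr1 subrr.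
- by rewrite opprK; apply: sv.2.
by rewrite mulrNz scaleNr opprK scale1r.
Qed.

End SimpleRoots.
End HighestWeight.

Section Indices.
Variables m n : nat.
Local Notation N := (m + n).+1.
Local Notation ix := (@ix m n).

Lemma ixK (i : 'I_N) : ix i = i.
Proof. by apply: val_inj; rewrite val_ix // -ltnS ltn_ord. Qed.

Lemma ix_eq i j : (i <= m + n)%N -> (j <= m + n)%N -> (ix i == ix j) = (i == j).
Proof. by move=> im jm; rewrite -val_eqE !val_ix. Qed.

Lemma par_ix i : (i <= m + n)%N -> par (ix i) = (m < i)%N.
Proof. by move=> im; rewrite /par val_ix. Qed.

Lemma pos_inj : (n <= m)%N -> injective (@pos m n).
Proof.
move=> nm i j; rewrite /pos => ij; apply: val_inj.
move: (ltn_ord i) (ltn_ord j) ij => /=.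
by move: (nat_of_ord i) (nat_of_ord j) => a b; do ![case: ifP => ?]; lia.
Qed.

Lemma pos_ext (k : 'I_N) : (n <= m)%N -> (@pos m n (ix 0) <= @pos m n k <= @pos m n (ix m))%N.
Proof.
move=> nm; rewrite /pos !val_ix; try lia; have := ltn_ord k.
by move: (nat_of_ord k) => a; do ![case: ifP => ?]; lia.
Qed.

Lemma pos_even i : (i <= m)%N -> @pos m n (ix i) = if (i < n)%N then (2 * i)%N else (n + i)%N.
Proof. by move=> im; rewrite /pos val_ix ?im //; lia. Qed.

Lemma pos_odd i : (i < n)%N -> @pos m n (ix (m.+1 + i)) = (2 * i).+1.
Proof. by move=> iN; rewrite /pos val_ix; [rewrite ifF; lia|lia]. Qed.

End Indices.

Section OddReflection.
Variables (R : realType) (m n : nat).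
Local Notation N := (m + n).+1.
Local Notation Mx := 'M[R[i]]_N.
Local Notation E p q := (delta_mx p q : Mx).
Local Notation in_g := (in_g m n).
Local Notation ix := (@ix m n).
Variables (V : lmodType R[i]) (sigma : V -> V).
Variables (rho : Mx -> int -> V -> V) (rK rd : V -> V).
Hypothesis HV : ghat_module m n sigma rho rK rd.
Hypothesis Hirr : irreducible m n rho rK rd.
Hypothesis nm : (n <= m)%N.
Variables (ps : 'I_N -> nat) (v : V) (p q : 'I_N).
Hypotheses (ps_inj : injective ps) (wv : weight_vector rho rK rd v) (v0 : v != 0).
Hypothesis sv : singular rho ps v.
Hypotheses (podd : par p = true) (qeven : par q = false) (adj : ps p = (ps q).+1).
Hypothesis isotropic : rho (E q q + E p p) 0 v = 0.

Let pq : p != q.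
Proof. by apply: contraFneq qeven => <-. Qed.

Let gpq : in_g (E p q). Proof. exact: in_g_delta. Qed.

Lemma odd_root_kill : rho (E p q) 0 v = 0.
Proof.
have lf := rho_lin HV 0 gpq.
apply: (@singular_lower_eq0 _ _ _ _ _ _ _ _ HV Hirr nm ps v p q 0 1) => //.
  by right; split=> //; rewrite adj.
have hf := homog_delta R p q.
split=> /= [k l kl|a r ga r0].
  have kl' : k != l by apply/eqP => e; rewrite e ltnn in kl.
  rewrite (rho_comm HV _ _ _ (in_g_delta R kl') gpq (homog_delta R k l) hf).
  rewrite sv.1 // (lin0 lf) scaler0 [LHS]add0r.
  rewrite [X in X *: rK v](_ : _ = 0); last by rewrite mulr0z mul0r.
  rewrite scale0r !addr0.
  rewrite /sbr; have [lp|lp] := eqVneq l p; have [kq|kq] := eqVneq k q.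
  - rewrite lp kq podd qeven !mul_delta_mx /= expr1 scaleN1r opprK.
    exact: isotropic.
  - rewrite lp mul_delta_mx mul_delta_mx_0 1?eq_sym // scaler0 subr0; apply: sv.1.
    have : ps k != ps q by apply: contraNneq kq => /ps_inj->.
    by move: kl; rewrite lp adj; lia.
  - rewrite mul_delta_mx_0 // kq mul_delta_mx sub0r -scaleNr (rhoZ HV).
      rewrite sv.1 ?scaler0 //.
      have : ps l != ps p by apply: contraNneq lp => /ps_inj->.
      by move: kl; rewrite kq adj; lia.
    by apply: in_g_delta; rewrite eq_sym.
  by rewrite mul_delta_mx_0 // mul_delta_mx_0 1?eq_sym // scaler0 subr0 (rho0 HV).
rewrite (part_sum a) (rhoD HV) ?in_g_part //.
have H t : rho (part m n t a) r (rho (E p q) 0 v) = 0.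
  have ha := homog_part t a; have ga' := in_g_part t ga.
  rewrite (rho_comm HV _ _ _ ga' gpq ha hf) oppr0 gt_eqF // scale0r addr0.
  rewrite sv.2 // (lin0 lf) scaler0 [LHS]add0r sv.2 ?addr0 //.
  by apply/eqP; apply: str_sbr.
by rewrite !H addr0.
Qed.

Lemma singular_odd_reflection : singular rho (fun k => ps (tperm q p k)) v.
Proof.
split=> [k l|]; last exact: sv.2.
have neq i j : i != j -> ps i != ps j by apply: contraNneq => /ps_inj->.
case: tpermP => [->|->|/eqP kq /eqP kp]; case: tpermP => [->|->|/eqP lq /eqP lp] kl;
  try (by rewrite adj in kl; lia); try (by rewrite ltnn in kl).
- by apply: sv.1; rewrite adj in kl; lia.
- exact: odd_root_kill.
- by apply: sv.1; have := neq _ _ lp; lia.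
- by apply: sv.1; have := neq _ _ kq; lia.
- by apply: sv.1; lia.
exact: sv.1.
Qed.

End OddReflection.

Section Weights.
Variables (R : realType) (m n : nat).
Local Notation N := (m + n).+1.
Local Notation Mx := 'M[R[i]]_N.
Local Notation E p q := (delta_mx p q : Mx).
Local Notation in_h := (in_h m n).
Local Notation ix := (@ix m n).
Hypothesis nm : (n <= m)%N.

Definition eps_coef (h : Mx) j : R[i] :=
  h (ix j) (ix j) - (if (j < n)%N then h (ix (m.+1 + j)) (ix (m.+1 + j)) else 0).

Lemma weight_formulaE (ks : nat -> nat) (h : Mx) x y :
  \sum_(j < n) (ks j)%:R * betaw m n j h x y
  + \sum_(n <= j < m) (ks j)%:R * epsw m n j h x y
  = \sum_(0 <= j < m) (ks j)%:R * eps_coef h j.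
Proof.
rewrite (big_cat_nat (leq0n n) nm) /= big_mkord; congr (_ + _).
  by apply: eq_bigr => j _; rewrite /eps_coef ltn_ord.
apply: eq_big_nat => j /andP[nj _].
by rewrite /eps_coef ltnNge nj subr0.
Qed.

Lemma eps_coef_coroot i j l : (i <= m)%N -> (j <= m)%N -> (l < m)%N ->
  eps_coef (E (ix i) (ix i) - E (ix j) (ix j)) l = (l == i)%:R - (l == j)%:R.
Proof.
move=> im jm lm; rewrite /eps_coef !mxE !andbb.
case: ifP => ln; rewrite !ix_eq ?subr0 //; try lia.
have [-> ->] : (m.+1 + l == i)%N = false /\ (m.+1 + l == j)%N = false by lia.
by rewrite !subr0.
Qed.

Lemma coroot_weight (ks : nat -> nat) i j : (i <= m)%N -> (j <= m)%N ->
  \sum_(0 <= l < m) (ks l)%:R * eps_coef (E (ix i) (ix i) - E (ix j) (ix j)) l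
  = (if (i < m)%N then ks i else 0%N)%:R - (if (j < m)%N then ks j else 0%N)%:R.
Proof.
move=> im jm; rewrite big_mkord.
have D k : (k <= m)%N -> \sum_(l < m) (ks l)%:R * (val l == k)%:R
    = (if (k < m)%N then ks k else 0%N)%:R :> R[i].
  move=> km; case: ifP => km'.
    rewrite (bigD1 (Ordinal km')) //= eqxx mulr1 big1 ?addr0 // => l lk.
    by rewrite -val_eqE /= in lk; rewrite (negPf lk) mulr0.
  rewrite big1 // => l _; have := ltn_ord l.
  by case: eqP => [->|_ _]; [rewrite km'|rewrite mulr0].
rewrite -!D // -sumrB; apply: eq_bigr => l _.
by rewrite eps_coef_coroot // mulrBr.
Qed.

Lemma in_h_hbeta j : (j < n)%N -> in_h (hbeta m n j : Mx).
Proof.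
move=> jn; rewrite /hbeta; apply/andP; split.
  apply/is_diag_mxP => k l kl; rewrite !mxE.
  have D i : (k == i) && (l == i) = false.
    by apply/negP => /andP[/eqP e /eqP e']; rewrite e e' eqxx in kl.
  by rewrite !D addr0.
have strE i : Defs.str m n (E i i) = (-1) ^+ par i.
  by rewrite -(mul_delta_mx i i) str_delta_l !mxE !eqxx mulr1.
rewrite /Defs.in_g -[X in X + _]scale1r str_linear !strE mul1r !par_ix; try lia.
have -> : (m < j)%N = false by lia.
have -> : (m < m.+1 + j)%N by lia.
by rewrite expr0 expr1 subrr.
Qed.

Lemma cartan_decomposition (h : Mx) : in_h h ->
  h = \sum_(j < n) h (ix (m.+1 + j)) (ix (m.+1 + j)) *: hbeta m n j
    + \sum_(j < m) eps_coef h j *: (E (ix j) (ix j) - E (ix m) (ix m)).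
Proof.
case/andP=> /is_diag_mxP dh /eqP gh; apply/matrixP => k l.
rewrite mxE !summxE.
have [->|kl] := eqVneq l k; last first.
  rewrite dh 1?eq_sym // !big1 ?addr0 // => j _; rewrite !mxE.
    have D i : (k == i) && (l == i) = false.
      by apply/negP => /andP[/eqP e /eqP e']; rewrite e e' eqxx in kl.
    by rewrite !D subrr mulr0.
  have D i : (k == i) && (l == i) = false.
    by apply/negP => /andP[/eqP e /eqP e']; rewrite e e' eqxx in kl.
  by rewrite !D addr0 mulr0.
have D (f : nat -> R[i]) j K : \sum_(i < K) f i * (j == i :> nat)%:R = if (j < K)%N then f j else 0.
  case: ifP => jK; last first.
    rewrite big1 // => i _; case: eqP => [e|_]; last by rewrite mulr0.
    by rewrite e ltn_ord in jK.
  rewrite (bigD1 (Ordinal jK)) //= eqxx mulr1 big1 ?addr0 // => i ij.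
  by rewrite -val_eqE /= eq_sym in ij; rewrite (negPf ij) mulr0.
have kN : (k <= m + n)%N by rewrite -ltnS.
rewrite -(ixK k); move: (nat_of_ord k) kN => {}k {l} kN.
have E1 : \sum_(i < n) (h (ix (m.+1 + i)) (ix (m.+1 + i)) *: hbeta m n i) (ix k) (ix k)
  = (if (k < n)%N then h (ix (m.+1 + k)) (ix (m.+1 + k)) else 0)
    + (if (m < k)%N then h (ix k) (ix k) else 0).
  under eq_bigr => i _ do rewrite !mxE !andbb mulrDr.
  rewrite big_split /=; congr (_ + _).
    rewrite -(D (fun i => h (ix (m.+1 + i)) (ix (m.+1 + i)))); apply: eq_bigr => i _.
    by rewrite ix_eq //; have := ltn_ord i; lia.
  case: ifP => mk.
    have := D (fun i => h (ix (m.+1 + i)) (ix (m.+1 + i))) (k - m.+1)%N n.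
    rewrite ifT; last by lia.
    rewrite subnKC // => <-; apply: eq_bigr => i _.
    rewrite ix_eq //; last by have := ltn_ord i; lia.
    by congr (_ * _%:R); lia.
  rewrite big1 // => i _; rewrite ix_eq //; last by have := ltn_ord i; lia.
  by have -> : (k == m.+1 + i)%N = false; [lia|rewrite mulr0].
have E2 : \sum_(i < m) (eps_coef h i *: (E (ix i) (ix i) - E (ix m) (ix m))) (ix k) (ix k)
  = (if (k < m)%N then eps_coef h k else 0) - (\sum_(i < m) eps_coef h i) * (k == m)%:R.
  rewrite mulr_suml -D -sumrB; apply: eq_bigr => i _.
  rewrite !mxE !andbb !ix_eq; try (have := ltn_ord i; lia).
  by rewrite mulrBr.
rewrite E1 E2.
have [km|km|->] := ltngtP k m.
- by rewrite mulr0 subr0 addr0 /eps_coef addrC subrK.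
- have -> : (k < n)%N = false by lia.
  by rewrite mulr0 subr0 add0r addr0.
have -> : (m < n)%N = false by lia.
rewrite mulr1 !add0r; apply/eqP; rewrite -addr_eq0 -[X in _ == X]gh str_even_odd.
rewrite big_ord_recr /= sumrB -big_mkcond /= -(big_ord_widen m (fun i => h (ix (m.+1 + i)) (ix (m.+1 + i))) nm).
apply/eqP.
by rewrite addrAC addrC addrCA addrC.
Qed.

End Weights.

(** * The highest weight *)

Section Functionals.
Variables (R : realType) (m n : nat).
Local Notation N := (m + n).+1.
Local Notation Mx := 'M[R[i]]_N.
Local Notation E p q := (delta_mx p q : Mx).
Local Notation in_h := (in_h m n).
Local Notation ix := (@ix m n).
Variable Lam : Mx -> R[i] -> R[i] -> R[i].
Hypothesis HLam : wlin m n Lam.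

Lemma Lam_linear (c : R[i]) (a b : Mx) : in_h a -> in_h b ->
  Lam (c *: a + b) 0 0 = c * Lam a 0 0 + Lam b 0 0.
Proof. by move=> ha hb; rewrite -HLam // !mulr0 !addr0. Qed.

Lemma Lam00 : Lam 0 0 0 = 0.
Proof.
have h0 := in_h0 R m n; have := Lam_linear (- 1) h0 h0.
by rewrite scaler0 addr0 mulN1r addNr.
Qed.

Lemma LamE h x y : in_h h -> Lam h x y = Lam h 0 0 + x * Lam 0 1 0 + y * Lam 0 0 1.
Proof.
move=> hh; have h0 := in_h0 R m n.
have -> : Lam h x y = y * Lam 0 0 1 + (x * Lam 0 1 0 + Lam h 0 0).
  by rewrite -!HLam ?in_h_lin // !scaler0 !add0r !mulr0 !mulr1 !addr0 add0r.
ring.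
Qed.

Lemma Lam_sum k (c : 'I_k -> R[i]) (H : 'I_k -> Mx) : (forall i, in_h (H i)) ->
  in_h (\sum_i c i *: H i) /\
  Lam (\sum_i c i *: H i) 0 0 = \sum_i c i * Lam (H i) 0 0.
Proof.
move=> hH; elim/big_rec2: _ => [|i x a _ [ha <-]]; first by rewrite in_h0 Lam00.
by rewrite in_h_lin // Lam_linear.
Qed.

Lemma Lam_cartan h : (n <= m)%N ->
  (forall j, (j < n)%N -> Lam (hbeta m n j) 0 0 = 0) -> in_h h ->
  Lam h 0 0 = \sum_(j < m) eps_coef h j * Lam (E (ix j) (ix j) - E (ix m) (ix m)) 0 0.
Proof.
move=> nm Hbeta hh; rewrite {1}(cartan_decomposition nm hh).
have hc (j : 'I_m) : in_h (E (ix j) (ix j) - E (ix m) (ix m)).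
  by apply: in_h_coroot; rewrite par_ix; have := ltn_ord j; lia.
have [h2 L2] := Lam_sum (fun j => eps_coef h j) hc.
have [h1 L1] := Lam_sum (fun j : 'I_n => h (ix (m.+1 + j)) (ix (m.+1 + j)))
  (fun j => in_h_hbeta R nm (ltn_ord j)).
rewrite -[X in Lam (X + _)]scale1r Lam_linear // mul1r L1 L2 big1 ?add0r // => j _.
by rewrite Hbeta // mulr0.
Qed.

End Functionals.

Theorem theorem5p4 (R : realType) (m n : nat) (Hn : (1 <= n)%N) (Hnm : (n <= m)%N)
    (Lam : 'M[R[i]]_((m + n).+1) -> R[i] -> R[i] -> R[i])
    (HLam : wlin m n Lam)
    (Hk : Lam 0 1 0 != 0)
    (Hbeta : forall i, (i < n)%N -> Lam (hbeta m n i) 0 0 = 0)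
    (V : lmodType R[i]) (sigma : V -> V)
    (rho : 'M[R[i]]_((m + n).+1) -> int -> V -> V) (rK rd : V -> V)
    (HV : ghat_module m n sigma rho rK rd)
    (v : V) (Hv : hw_vector m n sigma rho rK rd Lam v)
    (Hirr : irreducible m n rho rK rd) :
  integrable m n rho <->
  exists (k : nat) (ks : nat -> nat) (c : R[i]),
    [/\ (0 < k)%N, (ks 0 <= k)%N,
        (forall j, (j.+1 < m)%N -> (ks j.+1 <= ks j)%N) &
        forall h x y, in_h m n h ->
          Lam h x y = k%:R * Lambda0 m n h x y
                      + \sum_(j < n) (ks j)%:R * betaw m n j h x y
                      + \sum_(n <= j < m) (ks j)%:R * epsw m n j h x y
                      + c * deltaw m n h x y].
Proof.
have [[v0 sv] Hh [HK Hd] Hpos Hposr] := Hv.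
have wv : weight_vector rho rK rd v.
  by split; [move=> h hh; exists (Lam h 0 0); apply: Hh|exists (Lam 0 1 0)|exists (Lam 0 0 1)].
have sgv : singular rho (@pos m n) v by split.
have m0 : (0 < m)%N by lia.
pose e i := ix m n i.
pose H i j : 'M[R[i]]_((m + n).+1) := delta_mx (e i) (e i) - delta_mx (e j) (e j).
have ev i : (i <= m)%N -> par (e i) = false by move=> im; rewrite par_ix; lia.
have ne i j : (i <= m)%N -> (j <= m)%N -> i != j -> e i != e j.
  by move=> im jm; rewrite ix_eq; lia.
have hH i j : (i <= m)%N -> (j <= m)%N -> in_h m n (H i j).
  by move=> im jm; apply: in_h_coroot; apply: ev.
have pos_lt i j : (i < j <= m)%N -> (pos (e i) < pos (e j))%N.
  by move=> ij; rewrite !pos_even; try lia; do ![case: ifP => ?]; lia.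
split=> [[int0 int1]|[k [ks [c [k0 ksk ksS LamF]]]]].
  have integral i j : (i < j <= m)%N -> exists k : nat, Lam (H i j) 0 0 = k%:R.
    move=> ij; have ij' : (e i < e j <= m)%N by rewrite !val_ix; lia.
    have [N fN] := int0 _ _ ij' v.
    apply: (simple_root_integral HV (s := 0) (p := e j) (q := e i) _ _ _ v0 _ _ fN).
    - by apply: ev; lia.
    - by apply: ev; lia.
    - by apply: ne; lia.
    - by rewrite oppr0; apply: Hpos; apply: pos_lt.
    by rewrite mulr0z scale0r subr0 Hh // hH; lia.
  have /fin_all_exists[ks0 Hks0] (j : 'I_m) : exists k : nat, Lam (H j m) 0 0 = k%:R.
    by apply: integral; have := ltn_ord j; lia.
  pose ks j := if insub j is Some j' then ks0 j' else 0%N.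
  have Hks j : (j < m)%N -> Lam (H j m) 0 0 = (ks j)%:R.
    by move=> jm; rewrite /ks insubT /= -Hks0.
  have HB i j l : (i <= m)%N -> (j <= m)%N -> (l <= m)%N ->
      Lam (H i j) 0 0 = Lam (H i l) 0 0 - Lam (H j l) 0 0.
    move=> im jm lm; rewrite -mulN1r addrC -(Lam_linear HLam) ?hH //; congr (Lam _ 0 0).
    by rewrite scaleN1r /H opprB [RHS]addrC addrA subrK.
  have [d Hd0] : exists d : nat, Lam (H m 0) 0 0 + Lam 0 1 0 = d%:R.
    have em : e m != e 0 by apply: ne; lia.
    have [e0m emm] : (e 0 <= m)%N /\ (e m <= m)%N by rewrite !val_ix; lia.
    have [N fN] := int1 _ _ emm e0m em 1 ltr01 v.
    apply: (simple_root_integral HV (s := - 1) (p := e 0) (q := e m) _ _ _ v0 _ _ fN).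
    - by apply: ev.
    - by apply: ev.
    - by apply: ne; lia.
    - by rewrite opprK; apply: Hposr => //; apply: in_g_delta; apply: ne; lia.
    by rewrite mulrNz scaleNr opprK scale1r Hh ?hH // HK scalerDl.
  have LamK : Lam 0 1 0 = (d + ks 0)%:R.
    rewrite natrD -Hd0 -Hks // (HB m 0 m) //.
    by rewrite (HB m m m) // subrr sub0r addrAC addNr add0r.
  exists (d + ks 0)%N, ks, (Lam 0 0 1); split.
  - by move: Hk; rewrite LamK pnatr_eq0 lt0n.
  - exact: leq_addl.
  - move=> j jm; have [|l Hl] := integral j j.+1; first by lia.
    rewrite -(ler_nat R[i]) -subr_ge0 -!Hks; try lia.
    by rewrite -HB ?Hl ?ler0n; lia.
  move=> h x y hh; rewrite (LamE HLam _ _ hh) LamK.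
  rewrite -[X in X + _ * deltaw _ _ _ _ _]addrA weight_formulaE // (Lam_cartan HLam Hnm Hbeta hh).
  rewrite /Lambda0 /deltaw [X in X + _ = _]addrC (mulrC x) (mulrC y).
  congr (_ + _ + _); rewrite big_mkord; apply: eq_bigr => j _.
  by rewrite -Hks // mulrC.
have LamH i j : (i <= m)%N -> (j <= m)%N -> Lam (H i j) 0 0
    = (if (i < m)%N then ks i else 0%N)%:R - (if (j < m)%N then ks j else 0%N)%:R.
  move=> im jm; rewrite LamF ?hH // -[X in X + _ * deltaw _ _ _ _ _]addrA.
  by rewrite weight_formulaE // coroot_weight // /Lambda0 /deltaw !mulr0 add0r addr0.
have LamK : Lam 0 1 0 = k%:R.
  rewrite LamF ?in_h0 // /Lambda0 /deltaw mulr1 mulr0 !big1 ?addr0 // => j _.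
    by rewrite /epsw mxE mulr0.
  by rewrite /betaw /epsw /deltw !mxE subrr mulr0.
apply: (integrable_of_simple HV Hirr v0).
- by move=> i j ij; apply: Hpos; apply: pos_lt.
- move=> i im.
  have [p0 q0 pq] : [/\ par (e i.+1) = false, par (e i) = false & e i.+1 != e i].
    by split; [apply: ev|apply: ev; lia|apply: ne; lia].
  pose k' := (ks i - (if (i.+1 < m)%N then ks i.+1 else 0))%N.
  have hv : rho (H i i.+1) 0 v = k'%:R *: v.
    rewrite Hh ?hH; try lia; rewrite LamH; try lia; rewrite im -natrB //.
    by case: ifP => // im'; apply: ksS.
  apply: (loc_nilpotent_vector HV Hirr p0 q0 pq v0 (k := k'.+1)).
  have [iN|iN] := ltnP i n; last first.
    apply: (finite_simple_root_kill HV Hirr Hnm (pos_inj Hnm) wv v0 sgv) => //.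
    by rewrite !pos_even; try lia; do ![case: ifP => ?]; lia.
  pose o := ix m n (m.+1 + i).
  have po : pos o = (2 * i).+1 by apply: pos_odd.
  have pe : pos (e i) = (2 * i)%N by rewrite pos_even ?iN //; lia.
  have oodd : par o = true by rewrite par_ix; lia.
  have iso : rho (delta_mx (e i) (e i) + delta_mx o o) 0 v = 0.
    by rewrite -/(hbeta m n i) Hh ?in_h_hbeta // Hbeta // scale0r.
  have adj : pos o = (pos (e i)).+1 by rewrite po pe.
  have sg' := singular_odd_reflection HV Hirr Hnm (pos_inj Hnm) wv v0 sgv oodd q0 adj iso.
  apply: (finite_simple_root_kill HV Hirr Hnm _ wv v0 sg') => //.
    by move=> x y /(pos_inj Hnm)/perm_inj.
  rewrite tpermL tpermD; first by rewrite po pos_even //; case: ifP => ?; lia.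
    by rewrite eq_sym.
  by apply: contraTneq oodd => ->; rewrite p0.
move=> _; have em : e 0 != e m by apply: ne; lia.
apply: (loc_nilpotent_vector HV Hirr (ev _ (leq0n m)) (ev _ (leqnn m)) em v0
  (k := (k - ks 0).+1)).
apply: (affine_simple_root_kill HV Hirr Hnm (pos_inj Hnm) wv v0 sgv) => //; try exact: ev.
  by move=> l; apply: pos_ext.
rewrite -/(H m 0) Hh ?hH // HK -scalerDl LamH // ltnn m0 LamK natrB //.
by congr (_ *: _); ring.
Qed.
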